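(* Let $K$ be a number field, $A/K$ an abelian variety, $p$ a prime and $K\subset K_1\subset K_2\subset\dots$ a tower of finite Galois extensions of $K$. Suppose both $|A(K_n)[p^\infty]|$ and $\mathrm{rk}_pA/K_n$ are bounded as $n\to\infty$. (1) There exists $n_0$ such that the restriction maps $J_{n,n'}:\mathrm{Sel}^{\mathrm{div}}_{p^\infty}(A/K_n)\to\mathrm{Sel}^{\mathrm{div}}_{p^\infty}(A/K_{n'})$ are isomorphisms for all $n_0\le n\le n'$. (2) If $\phi:A\to A'$ is an isogeny, then $|\mathrm{Sel}^{\mathrm{div}}_{p^\infty}(A/K_n)[\phi]|$ is eventually constant, equal to $p^\lambda$ for some $0\le\lambda\le\mathrm{ord}_p\deg\phi\cdot\lim_{n\to\infty}\mathrm{rk}_pA/K_n$.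
   Context: $\mathrm{Sel}_{p^\infty}(A/F)=\varinjlim_m\mathrm{Sel}_{p^m}(A/F)$, $\mathrm{Sel}^{\mathrm{div}}_{p^\infty}(A/F)$ its maximal divisible subgroup, and $\mathrm{rk}_pA/F$ the $\mathbb{Z}_p$-corank of $\mathrm{Sel}_{p^\infty}(A/F)$. $X[\phi]$ is the $\phi$-torsion and $X[p^\infty]$ the $p$-primary part of an abelian group $X$. *)

(* Defs.v *)
From HB Require Import structures.
From mathcomp Require Import all_boot all_order all_algebra all_field.
From mathcomp Require Import finmap boolp classical_sets functions cardinality.
From mathcomp Require Import reals.
From mathcomp Require Import freeg mpoly.

Set Implicit Arguments.
Unset Strict Implicit.
Unset Printing Implicit Defensive.

Import Order.TTheory GRing.Theory Num.Theory.
Import Quotient.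

Local Open Scope classical_set_scope.
Local Open Scope card_scope.
Local Open Scope ring_scope.
Local Open Scope quotient_scope.

(* The algebraic numbers [algC] serve as the common algebraic closure: number
   fields are subfields of [algC] of finite dimension over Q. *)

Record numField := NumField {
  nf_pred :> {pred algC};
  nf_divring : divring_closed nf_pred;
  nf_findim : exists s : seq algC, forall x, x \in nf_pred ->
    exists c : 'I_(size s) -> rat, x = \sum_i ratr (c i) * s`_i }.

HB.instance Definition _ (K : numField) :=
  GRing.isDivringClosed.Build algC (nf_pred K) (nf_divring K).

Record finExt (K : numField) := FinExt {
  fe_field :> numField;
  fe_sub : {subset K <= fe_field} }.

(* Ring endomorphisms of [algC] are automatically bijective. *)
Notation Aut := {rmorphism algC -> algC}.

Definition in_gal (F : {pred algC}) (sigma : Aut) := {in F, sigma =1 id}.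

(* In characteristic 0 every extension is separable, so that Galois means
   normal. *)
Definition galois_ext (K : numField) (F : finExt K) :=
  forall sigma : Aut, in_gal K sigma -> forall x, x \in F -> sigma x \in F.

(* [proj L N] is the set of lines in L^N, i.e. the L-points of projective
   (N-1)-space; two non-zero row vectors are identified when they have the same
   row space. *)

Section ProjectiveSpace.
Variables (L : fieldType) (N : nat).

Definition nzvec := {v : 'rV[L]_N | v != 0}.

Definition peq (u v : nzvec) := (val u == val v)%MS.

Lemma peq_is_equiv : equiv_class_of peq.
Proof.
split=> [u|u v|v u w]; rewrite /peq ?submx_refl //; first by rewrite andbC.
move=> /andP[uv vu] /andP[vw wv].
by rewrite (submx_trans uv vw) (submx_trans wv vu).
Qed.

Canonical peq_equiv := EquivRelPack peq_is_equiv.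
Canonical peq_encModRel := defaultEncModRel peq.

Definition proj := {eq_quot peq}.

HB.instance Definition _ : EqQuotient nzvec peq proj := EqQuotient.on proj.
HB.instance Definition _ := Choice.on proj.

Definition pcls (v : 'rV[L]_N) (nz_v : v != 0) : proj :=
  \pi_proj (exist (fun v => v != 0) v nz_v : nzvec).

Definition pvec (x : proj) : 'rV[L]_N := val (repr x).

Lemma pvec_neq0 x : pvec x != 0. Proof. exact: valP (repr x). Qed.

Lemma pvec_pcls v nz_v : (pvec (@pcls v nz_v) :=: v)%MS.
Proof.
apply/eqmxP; have /eqP := reprK (@pcls v nz_v).
by rewrite /pcls piE.
Qed.

Lemma proj_eqP x y : reflect (x = y) (pvec x == pvec y)%MS.
Proof.
apply: (iffP idP) => [xy|->]; last by rewrite submx_refl.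
by rewrite -[x]reprK -[y]reprK; apply/eqP; rewrite piE.
Qed.

End ProjectiveSpace.

Lemma map_mx_neq0 (L L' : fieldType) (h : {rmorphism L -> L'}) N
    (v : 'rV[L]_N) : v != 0 -> map_mx h v != 0.
Proof. by rewrite map_mx_eq0. Qed.

Definition proj_map (L L' : fieldType) (h : {rmorphism L -> L'}) N
    (x : proj L N) : proj L' N := pcls (map_mx_neq0 h (pvec_neq0 x)).

Lemma pvec_proj_map (L L' : fieldType) (h : {rmorphism L -> L'}) N
    (x : proj L N) : (pvec (proj_map h x) :=: map_mx h (pvec x))%MS.
Proof. exact: pvec_pcls. Qed.

(* The value at [v] of [f], a polynomial with coefficients in [algC], in an
   extension [iota : algC -> L]. *)
Definition eval_in (L : fieldType) (iota : {rmorphism algC -> L}) N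
    (f : {mpoly algC[N]}) (v : 'rV[L]_N) : L := mmap iota (v 0) f.

Record projVar (K : numField) := ProjVar {
  pv_N : nat;
  pv_eqs : seq {mpoly algC[pv_N]};
  pv_homog : forall f, f \in pv_eqs -> exists d : nat, f \is d.-homog;
  pv_over : forall f, f \in pv_eqs -> f \is a mpolyOver pv_N K }.

Definition on_var K (V : projVar K) (L : fieldType)
    (iota : {rmorphism algC -> L}) (v : 'rV[L]_(pv_N V)) : bool :=
  all (fun f => eval_in iota f v == 0) (pv_eqs V).

Definition pts K (V : projVar K) (L : fieldType)
    (iota : {rmorphism algC -> L}) :=
  {x : proj L (pv_N V) | on_var iota (pvec x)}.

Definition id_algC : Aut := idfun.

(* The points over the algebraic closure. *)
Notation gpts V := (pts V id_algC).

Definition var_irreducible K (V : projVar K) :=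
  forall (d e : nat) (f g : {mpoly algC[pv_N V]}),
    f \is d.-homog -> g \is e.-homog ->
    (forall x : gpts V, eval_in id_algC f (pvec (val x)) = 0 \/
                        eval_in id_algC g (pvec (val x)) = 0) ->
    (forall x : gpts V, eval_in id_algC f (pvec (val x)) = 0) \/
    (forall x : gpts V, eval_in id_algC g (pvec (val x)) = 0).

(* A morphism over [K] is given by finitely many local expressions ("charts"),
   each a tuple of homogeneous polynomials of one common degree with coefficients
   in [K].  Varieties being reduced, these define a morphism to [W] exactly when,
   at each point over each field, some chart does not vanish and the charts that
   do not vanish all give the same point, which lies on [W]. *)

Definition chart (N M : nat) := M.-tuple {mpoly algC[N]}.

Definition chart_over (K : numField) N M (c : chart N M) :=
  exists d : nat, forall j, tnth c j \is d.-homog /\ tnth c j \is a mpolyOver N K.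

Definition eval_chart (L : fieldType) (iota : {rmorphism algC -> L}) N M
    (c : chart N M) (v : 'rV[L]_N) : 'rV[L]_M :=
  \row_j eval_in iota (tnth c j) v.

(* As [w] is non-zero, this says that some chart does not vanish at [v] and
   sends the point [v] to the point [w]. *)
Definition graph (L : fieldType) (iota : {rmorphism algC -> L}) N M
    (cs : seq (chart N M)) (v : 'rV[L]_N) (w : proj L M) : bool :=
  has (fun c => (eval_chart iota c v == pvec w)%MS) cs.

(* The Segre embedding, through which products of projective varieties are
   projective varieties. *)
Definition segre (L : fieldType) N M (v : 'rV[L]_N) (w : 'rV[L]_M) :
  'rV[L]_(N * M) := mxvec (v^T *m w).

Record regMap K (V W : projVar K) := RegMap {
  mor_charts : seq (chart (pv_N V) (pv_N W));
  mor_over : forall c, c \in mor_charts -> chart_over K c;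
  morP : forall (L : fieldType) (iota : {rmorphism algC -> L})
    (x : pts V iota),
    exists y : pts W iota,
      graph iota mor_charts (pvec (val x)) =1 pred1 (val y) }.

Record regMap2 K (V W U : projVar K) := RegMap2 {
  mor2_charts : seq (chart (pv_N V * pv_N W) (pv_N U));
  mor2_over : forall c, c \in mor2_charts -> chart_over K c;
  mor2P : forall (L : fieldType) (iota : {rmorphism algC -> L})
    (x : pts V iota) (y : pts W iota),
    exists z : pts U iota,
      graph iota mor2_charts (segre (pvec (val x)) (pvec (val y)))
        =1 pred1 (val z) }.

Lemma mor_ex K (V W : projVar K) (f : regMap V W) (L : fieldType)
    (iota : {rmorphism algC -> L}) (x : pts V iota) :
  exists y : pts W iota, graph iota (mor_charts f) (pvec (val x)) (val y).
Proof. by have [y fxy] := morP f x; exists y; rewrite fxy /= eqxx. Qed.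

Lemma mor2_ex K (V W U : projVar K) (f : regMap2 V W U) (L : fieldType)
    (iota : {rmorphism algC -> L}) (x : pts V iota) (y : pts W iota) :
  exists z : pts U iota,
    graph iota (mor2_charts f) (segre (pvec (val x)) (pvec (val y))) (val z).
Proof. by have [z fxyz] := mor2P f x y; exists z; rewrite fxyz /= eqxx. Qed.

Definition mor_app K (V W : projVar K) (f : regMap V W) (L : fieldType)
    (iota : {rmorphism algC -> L}) (x : pts V iota) : pts W iota :=
  xchoose (mor_ex f x).

Definition mor2_app K (V W U : projVar K) (f : regMap2 V W U) (L : fieldType)
    (iota : {rmorphism algC -> L}) (x : pts V iota) (y : pts W iota) :
    pts U iota :=
  xchoose (mor2_ex f x y).

Lemma mor_appE K (V W : projVar K) (f : regMap V W) (L : fieldType)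
    (iota : {rmorphism algC -> L}) (x : pts V iota) (y : pts W iota) :
  graph iota (mor_charts f) (pvec (val x)) (val y) = (y == mor_app f x).
Proof.
have [z fx] := morP f x.
have := xchooseP (mor_ex f x); rewrite -/(mor_app f x) !fx /= => /eqP <-.
by rewrite val_eqE.
Qed.

Lemma mor2_appE K (V W U : projVar K) (f : regMap2 V W U) (L : fieldType)
    (iota : {rmorphism algC -> L}) (x : pts V iota) (y : pts W iota)
    (z : pts U iota) :
  graph iota (mor2_charts f) (segre (pvec (val x)) (pvec (val y))) (val z)
    = (z == mor2_app f x y).
Proof.
have [t fxy] := mor2P f x y.
have := xchooseP (mor2_ex f x y).
rewrite -/(mor2_app f x y) !fxy /= => /eqP <-.
by rewrite val_eqE.
Qed.

Section BaseChange.
Variables (K : numField) (L L' : fieldType).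
Variables (iota : {rmorphism algC -> L}) (iota' : {rmorphism algC -> L'}).
Variable h : {rmorphism L -> L'}.
Hypothesis hK : {in K, h \o iota =1 iota'}.

Lemma eval_in_map N (f : {mpoly algC[N]}) (v : 'rV[L]_N) :
  f \is a mpolyOver N K ->
  eval_in iota' f (map_mx h v) = h (eval_in iota f v).
Proof.
move=> /(mpolyOverP (nf_pred K)) fK; rewrite /eval_in /mmap rmorph_sum /=.
apply: eq_bigr => m _; rewrite rmorphM -(hK (fK m)) /=; congr (_ * _).
rewrite /mmap1 rmorph_prod; apply: eq_bigr => i _.
by rewrite rmorphXn mxE.
Qed.

Lemma eval_in_scale N (f : {mpoly algC[N]}) (d : nat) (a : L) (v : 'rV[L]_N) :
  f \is d.-homog -> eval_in iota f (a *: v) = a ^+ d * eval_in iota f v.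
Proof.
move=> /dhomogP fd; rewrite /eval_in /mmap mulr_sumr !big_seq.
apply: eq_bigr => m mf; rewrite mulrCA; congr (_ * _).
have <- : mdeg m = d := fd _ mf.
rewrite /mmap1 mdegE -prodrXr -big_split /=.
by apply: eq_bigr => i _; rewrite mxE exprMn.
Qed.

End BaseChange.

Lemma eqmx_scaleP (L : fieldType) N (u v : 'rV[L]_N) :
  u != 0 -> (u == v)%MS -> exists2 a, a != 0 & u = a *: v.
Proof.
move=> u0 /andP[/sub_rVP[a def_u] _]; exists a => //.
by apply: contraNneq u0 => a0; rewrite def_u a0 scale0r.
Qed.

Lemma on_var_eqmx K (V : projVar K) (L : fieldType)
    (iota : {rmorphism algC -> L}) (u v : 'rV[L]_(pv_N V)) :
  u != 0 -> (u == v)%MS -> on_var iota v -> on_var iota u.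
Proof.
move=> u0 /(eqmx_scaleP u0)[a a0 ->] /allP Vv; apply/allP => f fV.
have [d fd] := pv_homog fV.
by rewrite (eval_in_scale _ _ _ fd) (eqP (Vv f fV)) mulr0.
Qed.

Lemma on_var_map (K : numField) (V : projVar K) (L L' : fieldType)
    (iota : {rmorphism algC -> L}) (iota' : {rmorphism algC -> L'})
    (h : {rmorphism L -> L'}) v :
  {in K, h \o iota =1 iota'} ->
  on_var iota v -> on_var (V := V) iota' (map_mx h v).
Proof.
move=> hK /allP Vv; apply/allP => f fV.
by rewrite (eval_in_map hK _ (pv_over fV)) (eqP (Vv f fV)) rmorph0.
Qed.

Lemma on_var_proj_map (K : numField) (V : projVar K) (L L' : fieldType)
    (iota : {rmorphism algC -> L}) (iota' : {rmorphism algC -> L'})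
    (h : {rmorphism L -> L'}) (x : pts V iota) :
  {in K, h \o iota =1 iota'} -> on_var (V := V) iota' (pvec (proj_map h (val x))).
Proof.
move=> hK; apply: (on_var_eqmx (pvec_neq0 _) (introT eqmxP (pvec_proj_map _ _))).
exact: (on_var_map hK (valP x)).
Qed.

Record ratPoint K (V : projVar K) := RatPoint {
  rp_vec : 'rV[algC]_(pv_N V);
  rp_neq0 : rp_vec != 0;
  rp_over : forall j, rp_vec 0 j \in K;
  rp_on : on_var id_algC rp_vec }.

Lemma rp_app_subproof K (V : projVar K) (z : ratPoint V) (L : fieldType)
    (iota : {rmorphism algC -> L}) :
  on_var iota (pvec (pcls (map_mx_neq0 iota (rp_neq0 z)))).
Proof.
apply: (on_var_eqmx (pvec_neq0 _) (introT eqmxP (pvec_pcls _))).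
by apply: on_var_map (rp_on z).
Qed.

Definition rp_app K (V : projVar K) (z : ratPoint V) (L : fieldType)
    (iota : {rmorphism algC -> L}) : pts V iota :=
  exist (fun x : proj L (pv_N V) => on_var iota (pvec x)) _
    (rp_app_subproof z iota).

(* A projective geometrically irreducible group variety; being a variety in
   characteristic 0, it is automatically smooth.  Commutativity, a consequence of
   the other conditions, is included so that the points form a [zmodType]. *)

Record abVar (K : numField) := AbVar {
  av_var :> projVar K;
  av_irr : var_irreducible av_var;
  av_add : regMap2 av_var av_var av_var;
  av_opp : regMap av_var av_var;
  av_zero : ratPoint av_var;
  av_addA : forall (L : fieldType) (iota : {rmorphism algC -> L}),
    associative (@mor2_app _ _ _ _ av_add L iota);
  av_addC : forall (L : fieldType) (iota : {rmorphism algC -> L}),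
    commutative (@mor2_app _ _ _ _ av_add L iota);
  av_add0 : forall (L : fieldType) (iota : {rmorphism algC -> L}),
    left_id (rp_app av_zero iota) (@mor2_app _ _ _ _ av_add L iota);
  av_addN : forall (L : fieldType) (iota : {rmorphism algC -> L}),
    left_inverse (rp_app av_zero iota) (@mor_app _ _ _ av_opp L iota)
      (@mor2_app _ _ _ _ av_add L iota) }.

Section Points.
Variables (K : numField) (A : abVar K) (L : fieldType).
Variable iota : {rmorphism algC -> L}.

Definition avpts := pts A iota.

HB.instance Definition _ := SubChoice.copy avpts (pts A iota).
HB.instance Definition _ := GRing.isZmodule.Build avpts
  (@av_addA _ A L iota) (@av_addC _ A L iota)
  (@av_add0 _ A L iota) (@av_addN _ A L iota).

End Points.

Notation gavpts A := (avpts A id_algC).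

(* The map on points induced by a field morphism [h] over [K], i.e. such that
   [h \o iota] and [iota'] agree on [K] (lemma [val_pt_map]); the default value 0
   is only used when [h] is not over [K]. *)
Definition pt_map K (A : abVar K) (L L' : fieldType)
    (iota : {rmorphism algC -> L}) (iota' : {rmorphism algC -> L'})
    (h : {rmorphism L -> L'}) (x : avpts A iota) : avpts A iota' :=
  insubd (0 : avpts A iota') (proj_map h (val x)).

Lemma val_pt_map K (A : abVar K) (L L' : fieldType)
    (iota : {rmorphism algC -> L}) (iota' : {rmorphism algC -> L'})
    (h : {rmorphism L -> L'}) (x : avpts A iota) :
  {in K, h \o iota =1 iota'} ->
  val (pt_map iota' h x) = proj_map h (val x).
Proof.
move=> hK; rewrite /pt_map; apply: insubdK.
exact: (on_var_proj_map (V := A) x hK).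
Qed.

Section PtMapMorph.
Variables (K : numField) (L L' : fieldType).
Variables (iota : {rmorphism algC -> L}) (iota' : {rmorphism algC -> L'}).
Variable h : {rmorphism L -> L'}.
Hypothesis hK : {in K, h \o iota =1 iota'}.

Lemma eval_chart_map N M (c : chart N M) (v : 'rV[L]_N) : chart_over K c ->
  eval_chart iota' c (map_mx h v) = map_mx h (eval_chart iota c v).
Proof.
case=> d cK; apply/rowP => j; rewrite !mxE.
by rewrite (eval_in_map hK _ (cK j).2).
Qed.

Lemma graph_map N M (cs : seq (chart N M)) (v : 'rV[L]_N) (w : proj L M) :
  (forall c, c \in cs -> chart_over K c) -> graph iota cs v w ->
  graph iota' cs (map_mx h v) (proj_map h w).
Proof.
move=> csK /hasP[c c_cs cvw]; apply/hasP; exists c => //.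
rewrite (eval_chart_map _ (csK c c_cs)).
by rewrite !pvec_proj_map !map_submx.
Qed.

Lemma graph_scale N M (cs : seq (chart N M)) (a : L') (v : 'rV[L']_N)
    (w : proj L' M) :
  (forall c, c \in cs -> chart_over K c) -> a != 0 -> graph iota' cs v w ->
  graph iota' cs (a *: v) w.
Proof.
move=> csK a0 /hasP[c c_cs cvw]; apply/hasP; exists c => //.
have [d cK] := csK c c_cs.
suff -> : eval_chart iota' c (a *: v) = a ^+ d *: eval_chart iota' c v.
  by rewrite !(eqmx_scale _ (expf_neq0 d a0)).
apply/rowP => j; rewrite !mxE.
by rewrite (eval_in_scale _ _ _ (cK j).1).
Qed.

Lemma pvec_proj_mapE N (x : proj L N) :
  exists2 a, a != 0 & pvec (proj_map h x) = a *: map_mx h (pvec x).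
Proof.
exact: eqmx_scaleP (pvec_neq0 _) (introT eqmxP (pvec_proj_map _ _)).
Qed.

Lemma pt_mapD (A : abVar K) : 
  {morph pt_map (A := A) (iota := iota) iota' h : x y / x + y}.
Proof.
move=> x y; apply/eqP.
rewrite -[_ == _ + _](mor2_appE (av_add A)).
have [a a0 def_x] := pvec_proj_mapE (val x).
have [b b0 def_y] := pvec_proj_mapE (val y).
rewrite !val_pt_map // def_x def_y.
have -> : segre (a *: map_mx h (pvec (val x))) (b *: map_mx h (pvec (val y))) =
    (a * b) *: map_mx h (segre (pvec (val x)) (pvec (val y))).
  rewrite /segre map_mxvec map_mxM -map_trmx [(a *: _)^T]linearZ /=.
  by rewrite -scalemxAl -scalemxAr scalerA linearZ.
apply: graph_scale; rewrite ?mulf_neq0 //; first exact: mor2_over.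
apply: graph_map; first exact: mor2_over.
by rewrite mor2_appE.
Qed.

Lemma pt_map0 (A : abVar K) : pt_map (A := A) (iota := iota) iota' h 0 = 0.
Proof.
by apply: (addrI (pt_map iota' h (0 : avpts A iota))); rewrite -pt_mapD !addr0.
Qed.

Lemma pt_mapN (A : abVar K) :
  {morph pt_map (A := A) (iota := iota) iota' h : x / - x}.
Proof.
move=> x; apply: (addrI (pt_map iota' h x)).
by rewrite -pt_mapD !subrr pt_map0.
Qed.

Lemma pt_mapB (A : abVar K) :
  {morph pt_map (A := A) (iota := iota) iota' h : x y / x - y}.
Proof. by move=> x y; rewrite pt_mapD pt_mapN. Qed.

Lemma pt_map_mor (A B : abVar K) (f : regMap A B) (x : avpts A iota) :
  pt_map (A := B) iota' h (mor_app f x) = mor_app f (pt_map (A := A) iota' h x).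
Proof.
apply/eqP; rewrite -(mor_appE f).
have [a a0 def_x] := pvec_proj_mapE (val x).
rewrite !val_pt_map // def_x; apply: graph_scale => //; first exact: mor_over.
apply: graph_map; first exact: mor_over.
by rewrite (mor_appE f).
Qed.

End PtMapMorph.

Definition kpts_tors K (A : abVar K) (p : nat) (F : finExt K) :
    set (gavpts A) :=
  [set x : gavpts A | (exists2 v : 'rV[algC]_(pv_N A), forall j, v 0 j \in F &
              (v == pvec (val x))%MS) /\
           exists m : nat, x *+ (p ^ m) = 0].
Arguments kpts_tors {K} A p F _.

Definition av_app K (A B : abVar K) (f : regMap A B) (L : fieldType)
    (iota : {rmorphism algC -> L}) : avpts A iota -> avpts B iota :=
  @mor_app K A B f L iota.

Definition mor_ker K (A B : abVar K) (f : regMap A B) : set (gavpts A) :=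
  [set x : gavpts A | av_app f x = 0].

Record isogeny K (A B : abVar K) := Isogeny {
  iso_mor :> regMap A B;
  iso_hom : forall (L : fieldType) (iota : {rmorphism algC -> L}),
    {morph @av_app K A B iso_mor L iota : x y / x + y};
  iso_surj : forall y : gavpts B, exists x : gavpts A, av_app iso_mor x = y;
  iso_fin : finite_set (mor_ker iso_mor) }.

(* The order of the kernel, a reduced group scheme in characteristic 0. *)
Definition isog_deg K (A B : abVar K) (phi : isogeny A B) : nat :=
  #|` fset_set (mor_ker phi)|.

(* A 1-cochain on the absolute Galois group of [F] is represented by a function
   on all of [Aut], of which only the values on automorphisms fixing [F] matter:
   functions with the same such values are identified in [H1] below. *)

Definition gact K (A : abVar K) (sigma : Aut) (x : gavpts A) : gavpts A :=
  pt_map id_algC sigma x.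

(* Continuity is for the Krull topology on the Galois group and the discrete
   topology on A[p^m]. *)
Definition cocycle K (A : abVar K) (p m : nat) (F : finExt K)
    (c : Aut -> gavpts A) :=
  [/\ forall sigma, in_gal F sigma -> c sigma *+ (p ^ m) = 0,
      forall sigma tau, in_gal F sigma -> in_gal F tau ->
        c (sigma \o tau : Aut) = c sigma + gact sigma (c tau) &
      forall sigma, in_gal F sigma -> exists s : seq algC,
        forall tau, in_gal F tau -> {in s, sigma =1 tau} -> c tau = c sigma].

Definition coboundary K (A : abVar K) (p m : nat) (F : finExt K)
    (c : Aut -> gavpts A) :=
  exists2 P : gavpts A, P *+ (p ^ m) = 0 &
    forall sigma, in_gal F sigma -> c sigma = gact sigma P - P.

Lemma in_gal_ext K (F : finExt K) (sigma : Aut) :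
  in_gal F sigma -> {in K, sigma \o id_algC =1 id_algC}.
Proof. by move=> galF x Kx; rewrite /= galF ?(fe_sub _ Kx). Qed.

Lemma gactB K (A : abVar K) (F : finExt K) sigma :
  in_gal F sigma -> {morph @gact K A sigma : x y / x - y}.
Proof. by move=> /in_gal_ext galK; apply: pt_mapB. Qed.

Lemma mulrn_pow0 (M : zmodType) (p m k : nat) (x : M) :
  x *+ (p ^ m) = 0 -> x *+ (p ^ (m + k)) = 0.
Proof. by move=> x0; rewrite expnD mulrnA x0 mul0rn. Qed.

Definition Z1 K (A : abVar K) (p : nat) (F : finExt K) :
    {pred (Aut -> gavpts A)} :=
  fun c => `[< exists m, cocycle p m F c >].
Arguments Z1 {K} A p F.

Lemma Z1_zmod_closed K (A : abVar K) p F : zmod_closed (Z1 A p F).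
Proof.
split.
  apply/asboolP; exists 0%N; split=> [sigma _|sigma tau sF _|sigma _].
  - by rewrite mul0rn.
  - by rewrite add0r /gact pt_map0 //; apply: in_gal_ext sF.
  - by exists [::].
move=> c c' /asboolP[m [cp cM cC]] /asboolP[m' [cp' cM' cC']].
apply/asboolP; exists (m + m')%N; split=> [sigma sF|sigma tau sF tF|sigma sF].
- rewrite !fctE mulrnBl (mulrn_pow0 _ (cp _ sF)).
  by rewrite addnC (mulrn_pow0 _ (cp' _ sF)) subr0.
- by rewrite !fctE cM // cM' // (gactB sF) opprD addrACA.
have [[s cs] [s' cs']] := (cC _ sF, cC' _ sF).
exists (s ++ s') => tau tF st; rewrite !fctE (cs tau) ?(cs' tau) // => x xs.
  by apply: st; rewrite mem_cat xs orbT.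
by apply: st; rewrite mem_cat xs.
Qed.

HB.instance Definition _ K (A : abVar K) p F :=
  GRing.isZmodClosed.Build _ (Z1 A p F) (Z1_zmod_closed A p F).

Definition cocycles K (A : abVar K) p (F : finExt K) :=
  {c : Aut -> gavpts A | c \in Z1 A p F}.

HB.instance Definition _ K (A : abVar K) p F :=
  SubChoice.on (cocycles A p F).
HB.instance Definition _ K (A : abVar K) p F :=
  [SubChoice_isSubZmodule of cocycles A p F by <:].

Definition B1 K (A : abVar K) (p : nat) (F : finExt K) :
    {pred cocycles A p F} :=
  fun c => `[< exists m, coboundary p m F (val c) >].
Arguments B1 {K} A p F.

Lemma subBACA (M : zmodType) (x y z t : M) :
  (x - y) - (z - t) = (x - z) - (y - t).
Proof. by rewrite !opprD addrACA. Qed.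

Lemma B1P K (A : abVar K) p F (c : cocycles A p F) :
  reflect (exists m, coboundary p m F (val c)) (c \in B1 A p F).
Proof. exact: asboolP. Qed.

Lemma B1_zmod_closed K (A : abVar K) p F : zmod_closed (B1 A p F).
Proof.
split.
  apply/asboolP; exists 0%N, 0 => [|sigma sF]; first by rewrite mul0rn.
  by rewrite /gact pt_map0 ?subrr //; apply: in_gal_ext sF.
move=> c c' /asboolP[m [P Pm dP]] /asboolP[m' [P' Pm' dP']].
apply/asboolP; exists (m + m')%N, (P - P') => [|sigma sF].
  by rewrite mulrnBl (mulrn_pow0 _ Pm) addnC (mulrn_pow0 _ Pm') subr0.
have -> : val (c - c') sigma = val c sigma - val c' sigma.
  by rewrite (raddfB val).
rewrite (dP _ sF) (dP' _ sF) (gactB sF).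
exact: subBACA.
Qed.

HB.instance Definition _ K (A : abVar K) p F :=
  GRing.isZmodClosed.Build _ (B1 A p F) (B1_zmod_closed A p F).

(* The direct limit over [m] of the groups H^1(F, A[p^m]): its elements are
   represented by cocycles with values in some A[p^m], and two cocycles are equal
   in the limit when they become cohomologous in some A[p^m]. *)
Definition H1 K (A : abVar K) p (F : finExt K) := {quot (B1 A p F)}.

HB.instance Definition _ K (A : abVar K) p F := GRing.Zmodule.on (H1 A p F).

Definition h1_class K (A : abVar K) p (F : finExt K) (c : cocycles A p F) :
  H1 A p F := \pi_{quot (B1 A p F)} c.

Definition h1_repr K (A : abVar K) p (F : finExt K) (x : H1 A p F) :
  cocycles A p F := repr (x : {quot (B1 A p F)}).

(* Restriction from [F] to an extension [F'], i.e. restriction of cocycles to a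
   subgroup; the default value 0 is only used when [F'] does not contain [F]. *)
Definition h1_res K (A : abVar K) p (F F' : finExt K) (x : H1 A p F) :
  H1 A p F' := h1_class (insubd (0 : cocycles A p F') (val (h1_repr x))).
Arguments h1_res {K} A p F F' x.

Lemma av_appMn K (A B : abVar K) (phi : isogeny A B) (x : gavpts A) n :
  av_app phi (x *+ n) = av_app phi x *+ n.
Proof.
have phi0 : av_app phi (0 : gavpts A) = 0.
  by apply: (addrI (av_app phi (0 : gavpts A))); rewrite -iso_hom !addr0.
by elim: n => [|n IHn]; rewrite ?mulr0n // !mulrS iso_hom IHn.
Qed.

Lemma isog_Z1 K (A B : abVar K) (phi : isogeny A B) p (F : finExt K)
    (c : cocycles A p F) :
  (fun sigma => av_app phi (val c sigma)) \in Z1 B p F.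
Proof.
case: c => c /= /asboolP[m [cp cM cC]]; apply/asboolP; exists m.
split=> [sigma sF|sigma tau sF tF|sigma sF].
- rewrite -av_appMn cp //.
  by have := av_appMn phi (0 : gavpts A) 0; rewrite !mulr0n.
- rewrite cM // iso_hom; congr (_ + _).
  by rewrite /gact /av_app (pt_map_mor (in_gal_ext sF) phi).
by have [s cs] := cC _ sF; exists s => tau tF st; rewrite (cs tau).
Qed.

Definition h1_isog K (A B : abVar K) (phi : isogeny A B) p (F : finExt K)
    (x : H1 A p F) : H1 B p F :=
  h1_class (exist (fun c => c \in Z1 B p F) _ (isog_Z1 phi (h1_repr x))).

Lemma val_cocyclesB K (A : abVar K) p (F : finExt K) (c c' : cocycles A p F)
    sigma : val (c - c') sigma = val c sigma - val c' sigma.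
Proof. by rewrite (raddfB val). Qed.

Lemma h1_classP K (A : abVar K) p (F : finExt K) (c c' : cocycles A p F) :
  h1_class c = h1_class c' <->
  exists m, coboundary p m F (fun sigma => val c sigma - val c' sigma).
Proof.
have -> : (fun sigma => val c sigma - val c' sigma) = val (c - c').
  by apply/funext => sigma; rewrite val_cocyclesB.
split=> [cc'|/(introT (B1P (c - c')))]; last by rewrite idealrBE => /eqP.
by apply: (elimT (B1P (c - c'))); rewrite idealrBE; apply/eqP.
Qed.

Lemma h1_reprK K (A : abVar K) p (F : finExt K) (x : H1 A p F) :
  h1_class (h1_repr x) = x.
Proof. exact: reprK. Qed.

Lemma h1_resE K (A : abVar K) p (F F' : finExt K) (c : cocycles A p F)
    (c' : cocycles A p F') : {subset F <= F'} ->
  val c' = val c -> h1_res A p F F' (h1_class c) = h1_class c'.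
Proof.
move=> FF' cc'; have galS sigma : in_gal F' sigma -> in_gal F sigma.
  by move=> sF' x /FF'; apply: sF'.
have Z1S d : d \in Z1 A p F -> d \in Z1 A p F'.
  move=> /asboolP[m [dp dM dC]]; apply/asboolP; exists m.
  split=> [sigma /galS sF|sigma tau /galS sF /galS tF|sigma /galS sF].
  - exact: dp.
  - exact: dM.
  by have [s ds] := dC _ sF; exists s => tau /galS; apply: ds.
have [m [P Pm dP]] := proj1 (h1_classP _ _) (h1_reprK (h1_class c)).
apply/h1_classP; exists m, P; first exact: Pm.
move=> sigma sF'.
apply: etrans (dP _ (galS _ sF')).
apply: (congr2 (fun a b => a sigma - b sigma)) cc'.
by apply: insubdK; apply: Z1S; exact: valP.
Qed.

Lemma h1_isogE K (A B : abVar K) (phi : isogeny A B) p (F : finExt K)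
    (c : cocycles A p F) (c' : cocycles B p F) :
  val c' = (fun sigma => av_app phi (val c sigma)) ->
  h1_isog phi (h1_class c) = h1_class c'.
Proof.
move=> def_c'; have [m [P Pm dP]] :=
  proj1 (h1_classP _ _) (h1_reprK (h1_class c)).
apply/h1_classP.
have phiB x y : av_app phi (x - y) = av_app phi x - av_app phi y :> gavpts B.
  by apply: (addIr (av_app phi y)); rewrite -iso_hom !subrK.
exists m, (av_app phi P) => [|sigma sF].
  by rewrite -av_appMn Pm -[in LHS](subrr P) phiB subrr.
have gphi : gact sigma (av_app phi P) = av_app phi (gact sigma P).
  exact: (pt_map_mor (in_gal_ext sF) phi).
rewrite gphi def_c'; apply: etrans (phiB _ _).
apply: etrans (congr1 (fun z : gavpts A => av_app phi z) (dP _ sF)).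
by apply: esym; apply: phiB.
Qed.

(* A completion F_v of [F] at a place v, with an algebraic closure [cp_clos] of
   F_v and an embedding [cp_iota] of [algC] into it extending F -> F_v.  Places
   are given by non-trivial absolute values, archimedean or not. *)
Record completion (F : numField) := Completion {
  cp_real : realType;
  cp_field : fieldType;
  cp_abs : cp_field -> cp_real;
  cp_abs_ge0 : forall a, 0 <= cp_abs a;
  cp_abs_eq0 : forall a, (cp_abs a == 0) = (a == 0);
  cp_absM : {morph cp_abs : a b / a * b};
  cp_absD : forall a b, cp_abs (a + b) <= cp_abs a + cp_abs b;
  cp_nontriv : exists2 a, a != 0 & cp_abs a != 1;
  cp_complete : forall u : nat -> cp_field,
    (forall e, 0 < e -> exists n0, forall m n, (n0 <= m)%N -> (n0 <= n)%N ->
       cp_abs (u m - u n) < e) ->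
    exists l, forall e, 0 < e -> exists n0, forall n, (n0 <= n)%N ->
       cp_abs (u n - l) < e;
  cp_clos : closedFieldType;
  cp_in : {rmorphism cp_field -> cp_clos};
  cp_alg : forall x : cp_clos, exists2 f : {poly cp_field}, f != 0 &
    root (map_poly cp_in f) x;
  cp_iota : {rmorphism algC -> cp_clos};
  cp_sub : forall x, x \in F -> exists a, cp_in a = cp_iota x;
  cp_dense : forall a e, 0 < e -> exists x b,
    [/\ x \in F, cp_in b = cp_iota x & cp_abs (a - b) < e] }.

(* The class of [c] has trivial image in H^1(F_v, A) for all places v of [F];
   [tau] is the restriction of [sigma] along [cp_iota]. *)
Definition locally_trivial K (A : abVar K) (F : finExt K)
    (c : Aut -> gavpts A) :=
  forall v : completion F, exists P : avpts A (cp_iota v),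
  forall (sigma : {rmorphism cp_clos v -> cp_clos v}) (tau : Aut),
    sigma \o cp_in v =1 cp_in v -> cp_iota v \o tau =1 sigma \o cp_iota v ->
    pt_map (cp_iota v) (cp_iota v) (c tau) = pt_map (cp_iota v) sigma P - P.

(* The direct limit of the groups Sel_{p^m}(A/F), inside that of the groups
   H^1(F, A[p^m]). *)
Definition Sel K (A : abVar K) p (F : finExt K) : set (H1 A p F) :=
  [set x | exists2 c : cocycles A p F, locally_trivial F (val c) &
                                       x = h1_class c].
Arguments Sel {K} A p F _.

Definition subgroup (X : zmodType) (D : set X) :=
  D 0 /\ forall x y, D x -> D y -> D (x - y).

Definition divisible (X : zmodType) (D : set X) :=
  forall (n : nat) x, (0 < n)%N -> D x -> exists2 y, D y & y *+ n = x.

(* Divisible subgroups have a divisible sum, so that their union is the largest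
   one. *)
Definition maxdiv (X : zmodType) (S : set X) : set X :=
  [set x | exists D : set X,
     [/\ D `<=` S, subgroup D, divisible D & D x]].

Definition Seldiv K (A : abVar K) p (F : finExt K) : set (H1 A p F) :=
  maxdiv (Sel A p F).
Arguments Seldiv {K} A p F _.

Definition Seldiv_ker K (A B : abVar K) (phi : isogeny A B) p (F : finExt K) :
    set (H1 A p F) :=
  [set x : H1 A p F | Seldiv A p F x /\ h1_isog phi x = 0].
Arguments Seldiv_ker {K A B} phi p F _.

Definition group_iso (X Y : zmodType) (S : set X) (T : set Y) (f : X -> Y) :=
  (forall x y, S x -> S y -> f (x + y) = f x + f y) /\ set_bij S T f.

(* The Z_p-corank of a p-primary group [S] is the rank over Z_p, i.e. the maximal
   number of linearly independent elements, of its Pontryagin dual Hom(S, Q/Z).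
   A p-adic integer [a] acts on an element killed by p^m as its residue [a m]
   modulo p^m. *)

Definition rat_int : {pred rat} := fun q => q \is a Num.int.

Lemma rat_int_zmod_closed : zmod_closed rat_int.
Proof. by split=> [|x y xZ yZ]; rewrite /rat_int unfold_in ?rpred0 ?rpredB. Qed.

HB.instance Definition _ :=
  GRing.isZmodClosed.Build rat rat_int rat_int_zmod_closed.

Definition QZ := {quot rat_int}.
HB.instance Definition _ := GRing.Zmodule.on QZ.

Definition padic_int (p : nat) (a : nat -> int) :=
  forall m : nat, (a m.+1 = a m %[mod (p ^ m)%N])%Z.

Definition padic_eq0 (p : nat) (a : nat -> int) :=
  forall m : nat, ((p ^ m)%N %| a m)%Z.

Definition dual_elt (X : zmodType) (S : set X) (f : X -> QZ) :=
  forall x y, S x -> S y -> f (x + y) = f x + f y.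

Definition dual_indep (p : nat) (X : zmodType) (S : set X) (r : nat)
    (f : 'I_r -> X -> QZ) :=
  forall a : 'I_r -> nat -> int, (forall i, padic_int p (a i)) ->
    (forall (x : X) (m : nat), S x -> x *+ (p ^ m) = 0 ->
       \sum_i f i x *~ a i m = 0) ->
    forall i, padic_eq0 p (a i).

Definition corank_ge (p : nat) (X : zmodType) (S : set X) (r : nat) :=
  exists f : 'I_r -> X -> QZ,
    (forall i, dual_elt S (f i)) /\ dual_indep p S f.

(* The corank, a priori a natural number or infinite, is equal to [r]. *)
Definition is_corank (p : nat) (X : zmodType) (S : set X) (r : nat) :=
  corank_ge p S r /\ ~ corank_ge p S r.+1.

Definition is_rk K (A : abVar K) (p : nat) (F : finExt K) (r : nat) :=
  is_corank p (Sel A p F) r.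

(* Main.v *)
Require Import Defs.
From HB Require Import structures.
From mathcomp Require Import all_boot all_order all_algebra all_field.
From mathcomp Require Import finmap boolp classical_sets functions cardinality.
From mathcomp Require Import reals lra.

(** Let S_n be the Selmer group over K_n and D_n its maximal divisible subgroup.
    The kernel of restriction from K_n to K_n' consists of classes of cocycles
    with values in A(K_n')[p^oo], so it is killed by some p^B independent of n
    and n'.

    Since Q/Z is injective, the corank of S_n is therefore nondecreasing in n,
    and so eventually constant.  Lifting elements of D_n[p] through D_n shows that
    |D_n[p]| = p^(d_n) with d_n at most the corank of S_n, and |D_n[p^k]| =
    p^(d_n k).  Comparing these orders for large k, d_n is nondecreasing, and the
    restriction map from D_n to D_n' is onto as soon as d_n = d_n'.  From there on
    the kernels of the maps out of a fixed D_n form an increasing chain inside the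
    finite group D_n[p^B]; once it stops, the restriction maps are bijective.

    A class killed by phi is killed by p^a with a = ord_p (deg phi), so D_n[phi]
    has order at most |D_n[p^a]|, and restriction embeds it in D_n'[phi]. *)

Set Implicit Arguments.
Unset Strict Implicit.
Unset Printing Implicit Defensive.

Import Order.TTheory GRing.Theory Num.Theory.

(** * Subgroups of abelian groups *)

Section AbelianGroups.
Local Open Scope classical_set_scope.
Local Open Scope card_scope.
Local Open Scope ring_scope.

(** The degree of K_n' over K_n may grow without bound, so the kernel of restriction is controlled
    through its exponent and not its order: a group of at most B points of p-power order is killed
    by p^B. This is why divisible groups are compared through their p^k-torsion for large k, where a
    kernel of bounded exponent costs only a bounded factor. Coranks are ranks of duals, so they move
    up the tower by pushing functionals forward.

    That restriction respects Selmer groups requires a place below each place w of K_n'. It is built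
    inside the given completion: for F in F', F_v is the topological closure of F in F'_w. Two
    points need proof: the absolute value stays non-trivial there, and the closed field attached to
    F_v must be algebraic over it, which is arranged by keeping only the algebraic elements of the
    given one. *)

Definition additive_on (X Y : zmodType) (D : set X) (f : X -> Y) :=
  forall x y, D x -> D y -> f (x + y) = f x + f y.

Definition tors (X : zmodType) (D : set X) (n : nat) : set X :=
  [set x | D x /\ x *+ n = 0].

Definition primary (p : nat) (X : zmodType) (D : set X) :=
  forall x, D x -> exists m : nat, x *+ (p ^ m) = 0.

Definition adjoin (X : zmodType) (H : set X) (y : X) : set X :=
  [set x | exists h (i : int), H h /\ x = h + y *~ i].

Section Subgroups.
Variables (X : zmodType) (D : set X).
Hypothesis sgD : subgroup D.

Lemma subgroup0 : D 0. Proof. exact: sgD.1. Qed.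
Lemma subgroupB x y : D x -> D y -> D (x - y). Proof. exact: sgD.2. Qed.
Lemma subgroupN x : D x -> D (- x).
Proof. by rewrite -[- x]add0r; apply: subgroupB; apply: subgroup0. Qed.
Lemma subgroupD x y : D x -> D y -> D (x + y).
Proof. by move=> Dx Dy; rewrite -[y]opprK; apply/subgroupB/subgroupN. Qed.
Lemma subgroupMn x n : D x -> D (x *+ n).
Proof.
move=> Dx; elim: n => [|n IHn]; first exact: subgroup0.
by rewrite mulrS; apply: subgroupD.
Qed.
Lemma subgroupMz x k : D x -> D (x *~ k).
Proof.
case: k => n Dx; first exact: subgroupMn.
by rewrite NegzE mulrNz; apply/subgroupN/subgroupMn.
Qed.

Lemma tors_subgroup n : subgroup (tors D n).
Proof.
split=> [|x y [Dx xn] [Dy yn]]; first by split; [apply: subgroup0|rewrite mul0rn].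
by split; [apply: subgroupB|rewrite mulrnBl xn yn subrr].
Qed.

Section Morphisms.
Variables (Y : zmodType) (f : X -> Y).
Hypothesis addf : additive_on D f.

Lemma additive_on0 : f 0 = 0.
Proof. by apply: (addrI (f 0)); rewrite -addf ?addr0 //; apply: subgroup0. Qed.

Lemma additive_onB x y : D x -> D y -> f (x - y) = f x - f y.
Proof.
move=> Dx Dy; apply: (addIr (f y)); rewrite -addf ?subrK //.
exact: subgroupB.
Qed.

Lemma additive_onN x : D x -> f (- x) = - f x.
Proof.
by move=> Dx; rewrite -[- x]add0r additive_onB ?additive_on0 ?sub0r //;
  apply: subgroup0.
Qed.

Lemma additive_onMn x n : D x -> f (x *+ n) = f x *+ n.
Proof.
move=> Dx; elim: n => [|n IHn]; first exact: additive_on0.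
by rewrite !mulrS addf ?IHn //; apply: subgroupMn.
Qed.

Lemma additive_onMz x k : D x -> f (x *~ k) = f x *~ k.
Proof.
case: k => n Dx; first exact: additive_onMn.
by rewrite NegzE !mulrNz additive_onN ?[f (_ *~ _)]additive_onMn //;
  apply: subgroupMz.
Qed.

Lemma image_subgroup (E : set X) :
  E `<=` D -> subgroup E -> subgroup (f @` E).
Proof.
move=> ED sE; split; first by exists 0; [exact: sE.1 | exact: additive_on0].
move=> _ _ [x Ex <-] [y Ey <-]; exists (x - y); first exact: sE.2.
by rewrite additive_onB //; apply: ED.
Qed.

Lemma image_divisible (E : set X) :
  E `<=` D -> divisible E -> divisible (f @` E).
Proof.
move=> ED dE n _ n0 [x Ex <-]; have [y Ey <-] := dE n x n0 Ex.
by exists (f y); [exists y | rewrite additive_onMn //; apply: ED].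
Qed.

Lemma ker_subgroup : subgroup [set x | D x /\ f x = 0].
Proof.
split=> [|x y [Dx fx] [Dy fy]]; first by split; [apply: subgroup0|apply: additive_on0].
by split; [apply: subgroupB | rewrite additive_onB // fx fy subrr].
Qed.

Lemma additive_on_inj : (forall x, D x -> f x = 0 -> x = 0) ->
  forall x y, D x -> D y -> f x = f y -> x = y.
Proof.
move=> finj x y Dx Dy fxy; apply/eqP; rewrite -subr_eq0; apply/eqP.
by apply: finj; [apply: subgroupB | rewrite additive_onB // fxy subrr].
Qed.

End Morphisms.

(** Bezout: if [p] did not divide [k], then [y] would be an integral combination of [y *+ p] and
    [y *~ k], hence in [D]. *)
Lemma subgroup_coprime (p : nat) y (k : int) : prime p -> ~ D y ->
  D (y *+ p) -> D (y *~ k) -> (p %| k)%Z.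
Proof.
move=> pp Dy Dpy Dky; apply: contrapT => /negP pk; apply: Dy.
have cpk : coprimez p k by rewrite coprimezE prime_coprime.
have [[u v] /= uv] := coprimezP _ _ cpk.
rewrite -[y]mulr1z -uv mulrzDr (mulrC u) (mulrC v) 2!mulrzA.
by apply: subgroupD; apply: subgroupMz.
Qed.

End Subgroups.

Lemma card_setX_II (T U : Type) (A : set T) (B : set U) a b :
  A #= `I_a -> B #= `I_b -> A `*` B #= `I_(a * b).
Proof.
move=> /card_set_bijP[f [fA finj fsurj]] /card_set_bijP[g [gB ginj gsurj]].
apply/card_set_bijP; exists (fun z => f z.1 * b + g z.2)%N; split.
- move=> [x y] [/= /fA /= xa /gB /= yb].
  by apply: (@leq_trans ((f x).+1 * b)%N); 
    [rewrite mulSn addnC ltn_add2r | rewrite leq_mul2r xa orbT].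
- move=> [x y] [x' y'] /set_mem[/= Ax By] /set_mem[/= Ax' By'] exy.
  have gy : (g y < b)%N by apply: gB.
  have gy' : (g y' < b)%N by apply: gB.
  have := congr1 (modn^~ b) exy; rewrite /= !modnMDl !modn_small // => egy.
  have b0 : (0 < b)%N by apply: leq_trans gy.
  have := congr1 (divn^~ b) exy; rewrite /= !divnMDl // !divn_small // !addn0 => efx.
  by congr (_, _); [apply: finj | apply: ginj]; rewrite ?inE.
- move=> k /= kab; have b0 : (0 < b)%N by case: (b) kab; rewrite ?muln0.
  have [x Ax fx] : (f @` A) (k %/ b)%N by apply: fsurj; rewrite /= ltn_divLR.
  have [y By gy] : (g @` B) (k %% b)%N by apply: gsurj; rewrite /= ltn_mod.
  by exists (x, y) => //=; rewrite fx gy -divn_eq.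
Qed.

Lemma sub_card_II (T : Type) (A B : set T) a b :
  A `<=` B -> A #= `I_a -> B #= `I_b -> (a <= b)%N.
Proof.
move=> /subset_card_le AB Aa Bb.
by rewrite -card_le_II -(card_le_eql Aa) -(card_le_eqr Bb).
Qed.

Lemma sub_card_eq_II (T : choiceType) (A B : set T) a :
  A `<=` B -> A #= `I_a -> B #= `I_a -> A = B.
Proof.
move=> AB Aa Ba.
have fA : finite_set A by apply/finite_setP; exists a.
have fB : finite_set B by apply/finite_setP; exists a.
apply: fset_set_inj => //; apply/eqP.
rewrite eqEfcard (card_fset_set Aa) (card_fset_set Ba) leqnn andbT.
by rewrite -fset_set_sub.
Qed.

(** A set-theoretic section [s] of [f] over its image turns (k, y) -> k + s y into a bijection from
    kernel times image onto [G]. *)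
Lemma card_ker_im (X Y : zmodType) (G : set X) (f : X -> Y) a b :
  subgroup G -> additive_on G f ->
  [set x | G x /\ f x = 0] #= `I_a -> f @` G #= `I_b -> G #= `I_(a * b).
Proof.
move=> sG addf Ka Ib; have [s sP] : exists s : Y -> X, forall y, (f @` G) y ->
    G (s y) /\ f (s y) = y.
  suff /choice[s sP] : forall y, exists x, (f @` G) y -> G x /\ f x = y by exists s.
  move=> y; have [[x Gx fx]|nGy] := pselect ((f @` G) y); first by exists x.
  by exists 0.
pose K := [set x | G x /\ f x = 0].
pose h (z : X * Y) := z.1 + s z.2.
have fh z : (K `*` (f @` G)) z -> f (h z) = z.2.
  by move=> [[Gk fk] /sP[Gs fs]]; rewrite /h addf // fk fs add0r.
have hinj : {in K `*` (f @` G) &, injective h}.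
  move=> z t /set_mem Kz /set_mem Kt hzt.
  have e2 : z.2 = t.2 by rewrite -!fh ?hzt.
  by case: z t hzt e2 {Kz Kt} => [z1 z2] [t1 t2] /= + e2; rewrite /h /= e2 => /addIr->.
have -> : G = h @` (K `*` (f @` G)).
  apply/seteqP; split=> [x Gx|_ [[k y] /= [[Gk _] /sP[Gs _]] <-]]; last exact: subgroupD.
  have [Gs fs] := sP (f x) (ex_intro2 _ _ x Gx erefl).
  exists (x - s (f x), f x); last by rewrite /h /= subrK.
  split=> /=; last by exists x.
  by split; [apply: subgroupB | rewrite (additive_onB sG addf) // fs subrr].
rewrite (card_eql (inj_card_eq hinj)).
exact: card_setX_II.
Qed.

Section Adjoin.
Variables (X : zmodType) (H : set X) (p : nat) (y : X).
Hypotheses (sH : subgroup H) (pp : prime p) (Hy : ~ H y) (Hpy : H (y *+ p)).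

Lemma adjoin_subgroup : subgroup (adjoin H y).
Proof.
split; first by exists 0, 0; split; [apply: subgroup0 | rewrite mulr0z addr0].
move=> _ _ [h [i [Hh ->]]] [h' [i' [Hh' ->]]]; exists (h - h'), (i - i').
by split; [apply: subgroupB | rewrite mulrzBr opprD addrACA].
Qed.

Lemma sub_adjoin : H `<=` adjoin H y.
Proof. by move=> h Hh; exists h, 0; rewrite mulr0z addr0. Qed.

Lemma mem_adjoin : adjoin H y y.
Proof. by exists 0, 1; split; [apply: subgroup0 | rewrite add0r mulr1z]. Qed.

Lemma adjoin_sub (G : set X) : subgroup G -> H `<=` G -> G y ->
  adjoin H y `<=` G.
Proof.
move=> sG HG Gy _ [h [i [Hh ->]]].
by apply: subgroupD => //; [apply: HG | apply: subgroupMz].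
Qed.

(** As [y] has order exactly [p] modulo [H], each element is x + i y for a unique x in [H] and a
    unique 0 <= i < p. *)
Lemma card_adjoin k : H #= `I_k -> adjoin H y #= `I_(k * p).
Proof.
move=> Hk; pose h (z : X * nat) := z.1 + y *+ z.2.
have -> : adjoin H y = h @` (H `*` `I_p).
  apply/seteqP; split=> [_ [x [i [Hx ->]]]|_ [[x i] [Hx _] <-]]; last first.
    by exists x, i.
  have p_gt0 : 0 < p%:Z by rewrite ltz_nat prime_gt0.
  have modE : `|(i %% p)%Z|%N = (i %% p)%Z :> int.
    by rewrite gez0_abs // modz_ge0 // gt_eqF.
  exists (x + y *+ p *~ (i %/ p)%Z, `|(i %% p)%Z|%N).
    split=> /=; first by apply: subgroupD => //; apply: subgroupMz.
    by rewrite -ltz_nat modE ltz_pmod.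
  rewrite /h /= !pmulrn modE -addrA -mulrzA -mulrzDr mulrC.
  by rewrite -divz_eq.
rewrite (card_eql (inj_card_eq _)); first exact: card_setX_II.
have key (x x' : X) (i i' : nat) : (i <= i')%N -> (i' < p)%N -> H x -> H x' ->
    x + y *+ i = x' + y *+ i' -> i = i'.
  move=> ii' i'p Hx Hx' e; have: (p %| (i' - i)%N%:Z)%Z.
    apply: (subgroup_coprime sH pp Hy Hpy).
    rewrite -pmulrn mulrnBr //.
    suff -> : y *+ i' - y *+ i = x - x' by exact: subgroupB.
    by apply/eqP; rewrite subr_eq addrAC e addrC addKr.
  rewrite /dvdz /= => /dvdn_leq dl; apply/eqP; rewrite eqn_leq ii' /= -subn_eq0.
  rewrite -leqn0 leqNgt; apply/negP => /dl; rewrite leqNgt.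
  by rewrite (leq_ltn_trans (leq_subr _ _) i'p).
move=> [x i] [x' i'] /set_mem[/= Hx ip] /set_mem[/= Hx' i'p] e.
suff ei : i = i' by move: e; rewrite /h /= ei => /addIr->.
by have [ii'|/ltnW ii'] := leqP i i'; [|apply/esym]; apply: key e || apply: key (esym e).
Qed.

End Adjoin.

End AbelianGroups.

(** * Injectivity of Q/Z *)

Section RationalsModIntegers.
Local Open Scope classical_set_scope.
Local Open Scope ring_scope.
Local Open Scope quotient_scope.

Definition qz (x : rat) : QZ := \pi_QZ x.

Lemma qzB x y : qz (x - y) = qz x - qz y.
Proof. exact: (raddfB (\pi_QZ : rat -> QZ)). Qed.

Lemma qz_eq0 x : (qz x == 0) = (x \is a Num.int).
Proof.
have <- : qz 0 = 0 by rewrite -(subrr 0) qzB subrr.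
by rewrite /qz -Quotient.idealrBE subr0.
Qed.

Lemma qzMn x n : qz (x *+ n) = qz x *+ n.
Proof. exact: (raddfMn (\pi_QZ : {additive rat -> QZ})). Qed.

Lemma qzMz x k : qz (x *~ k) = qz x *~ k.
Proof. exact: (raddfMz (\pi_QZ : {additive rat -> QZ})). Qed.

Lemma qz_surj (q : QZ) : exists x, q = qz x.
Proof. by exists (repr q); rewrite /qz reprK. Qed.

Lemma QZ_divisible (q : QZ) n : (0 < n)%N -> exists q', q' *+ n = q.
Proof.
move=> n0; have [x ->] := qz_surj q; exists (qz (x / n%:R)).
by rewrite -qzMn -(mulr_natr (x / _)) divfK // pnatr_eq0 -lt0n.
Qed.

Lemma qz_inv_eq0 (p : nat) (k : int) : (0 < p)%N ->
  qz p%:R^-1 *~ k = 0 -> (p %| k)%Z.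
Proof.
move=> p0 /eqP; rewrite -qzMz qz_eq0 => /intrP[m].
have p0' : p%:R != 0 :> rat by rewrite pnatr_eq0 -lt0n.
rewrite -mulrzr mulrC => /(canRL (divfK p0')) km.
apply/dvdzP; exists m; apply/eqP; rewrite -(eqr_int rat) km intrM.
by rewrite pmulrn.
Qed.

Lemma pairMz (X Y : zmodType) (x : X) (y : Y) k : (x, y) *~ k = (x *~ k, y *~ k).
Proof.
rewrite [LHS]surjective_pairing; congr (_, _).
  exact: (raddfMz (fst : {additive (X * Y)%type -> X})).
exact: (raddfMz (snd : {additive (X * Y)%type -> Y})).
Qed.

(** A partial homomorphism is represented by its graph [G], and the condition on the pairs (0, u)
    says that the graph is single-valued. Zorn gives a maximal such graph, and divisibility of Q/Z
    shows that its domain is everything. *)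
Lemma QZ_injective (X : zmodType) (G : set (X * QZ)%type) :
  subgroup G -> (forall u, G (0, u) -> u = 0) ->
  exists f : X -> QZ, (forall x y, f (x + y) = f x + f y) /\
                      (forall x u, G (x, u) -> f x = u).
Proof.
move=> sG G0; pose good (H : set (X * QZ)%type) :=
  [/\ subgroup H, G `<=` H & forall u, H (0, u) -> u = 0].
have goodG : good G by split.
have [F FP totF|A [PA maxA]] := @Zorn_bigcup _ [set H | H = set0 \/ good H].
  have [[H0 FH0 [_ GH0 _]]|nF] := pselect (exists2 H, F H & good H); last first.
    left; apply/seteqP; split=> // x [H FH Hx].
    by case: (FP H FH) => [H0|gH]; [rewrite H0 in Hx | case: nF; exists H].
  right; have gF H z : F H -> H z -> good H.
    by move=> /FP[-> //|].
  split=> [|z Gz|u [H FH Hu]]; last 2 first.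
  - by exists H0 => //; apply: GH0.
  - by have [_ _] := gF _ _ FH Hu; apply.
  split; first by exists H0 => //; apply/GH0/sG.1.
  move=> x y [H FH Hx] [H' FH' Hy].
  have [[sH _ _] [sH' _ _]] := (gF _ _ FH Hx, gF _ _ FH' Hy).
  by case: (totF H H' FH FH') => HH'; [exists H' => //; apply: sH'.2 |
    exists H => //; apply: sH.2] => //; apply: HH'.
have {PA} [sA GA A0] : good A.
  case: PA => // A0; case: (maxA G); last by right.
  by rewrite A0; split=> // /(_ 0 sG.1).
have {maxA} domA y : exists u, A (y, u).
  apply: contrapT => nAy.
  (* The value to give to [y]. If some positive multiple of [y] is in the domain, the value at the
     least one, n y, is divided by n, and the other multiples in the domain are multiples of n y;
     otherwise the value is free and 0 is taken. *)
  have [q qP] : exists q, forall k u, A (y *~ k, u) -> u = q *~ k.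
    have [/cid[n0 n0P]|nP] := pselect (exists n : nat, (0 < n)%N /\ exists u, A (y *+ n, u)).
      have ex_n : exists n, `[< (0 < n)%N /\ exists u, A (y *+ n, u) >].
        by exists n0; apply/asboolP.
      case: (ex_minnP ex_n) => n /asboolP[n_gt0 [u Anu]] minn.
      have [q qn] := QZ_divisible u n_gt0; exists q => k v Akv.
      have An w m : A (y *~ (n%:Z * m), w) -> w = q *~ (n%:Z * m).
        rewrite !mulrzA -!pmulrn qn => Aw.
        have := sA.2 _ _ Aw (subgroupMz sA m Anu).
        have -> : (y *+ n *~ m, w) - (y *+ n, u) *~ m = (0, w - u *~ m).
          by rewrite pairMz; congr (_, _); rewrite /= subrr.
        by move=> /A0/eqP; rewrite subr_eq0 => /eqP.
      have n_gt0' : 0 < n%:Z by rewrite ltz_nat.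
      suff k0 : (k %% n)%Z = 0.
        by move: Akv; rewrite (divz_eq k n) k0 addr0 mulrC => /An.
      apply/eqP; rewrite eq_le modz_ge0 ?gt_eqF // andbT leNgt; apply/negP => k_gt0.
      have modE : `|(k %% n)%Z|%N = (k %% n)%Z :> int.
        by rewrite gez0_abs // ltW.
      have : (n <= `|(k %% n)%Z|)%N.
        apply: minn; apply/asboolP; split; first by rewrite -ltz_nat modE.
        exists (v - u *~ (k %/ n)%Z); rewrite pmulrn modE.
        have := sA.2 _ _ Akv (subgroupMz sA (k %/ n)%Z Anu).
        congr A; rewrite pairMz; congr (_, _) => /=.
        by rewrite {1}(divz_eq k n) mulrzDr (mulrC _ n%:Z) mulrzA -pmulrn addrC addKr.
      by rewrite -lez_nat modE leNgt ltz_pmod.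
    exists 0 => k u Aku; rewrite mul0rz; apply: A0.
    suff k0 : k = 0 by move: Aku; rewrite k0 mulr0z.
    case: k Aku => [[|n]|n] // Aku; case: nP; exists n.+1; split=> //.
      by exists u.
    exists (- u); have := subgroupN sA Aku; rewrite NegzE mulrNz; congr A.
    by congr (_, _); rewrite /= opprK.
  pose B := adjoin A (y, q).
  have AB : A `<=` B := sub_adjoin _.
  case: (maxA B).
    split=> //; move=> /(_ (y, q)) BA; apply: nAy; exists q; apply: BA.
    exact: mem_adjoin.
  right; split; [exact: adjoin_subgroup | by move=> z /GA/AB | ].
  move=> u [[h1 h2] [i [Ah e]]].
  move: e; rewrite pairMz => -[/esym/eqP + ->]; rewrite addr_eq0 => /eqP h1E.
  have := subgroupN sA Ah; rewrite h1E => Ah'.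
  have /qP/eqP : A (y *~ i, - h2) by move: Ah'; congr A; congr (_, _); rewrite /= opprK.
  by rewrite eqr_oppLR => /eqP->; rewrite addNr.
have [f fP] := choice domA.
have fA x u : A (x, u) -> f x = u.
  move=> Axu; have := sA.2 _ _ (fP x) Axu.
  have -> : (x, f x) - (x, u) = (0, f x - u) by congr (_, _); rewrite /= subrr.
  by move=> /A0/eqP; rewrite subr_eq0 => /eqP.
exists f; split=> [x y|x u /GA/fA] //; apply: fA.
exact: (subgroupD sA (fP x) (fP y)).
Qed.

End RationalsModIntegers.

(** * Primary groups and coranks *)

Section PrimaryGroups.
Local Open Scope classical_set_scope.
Local Open Scope card_scope.
Local Open Scope ring_scope.

(** Prescribing 0 on [H] and 1/p at [y] is consistent because [y] has order exactly [p] modulo [H];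
    injectivity of Q/Z extends this to [X]. *)
Lemma QZ_separation (X : zmodType) (H : set X) (p : nat) (y : X) :
  subgroup H -> prime p -> ~ H y -> H (y *+ p) ->
  exists f : X -> QZ, [/\ forall u v, f (u + v) = f u + f v,
    forall h, H h -> f h = 0 & f y = qz p%:R^-1].
Proof.
move=> sH pp Hy Hpy; pose H' : set (X * QZ)%type := [set z | H z.1 /\ z.2 = 0].
have sH' : subgroup H'.
  split=> [|z t [Hz z0] [Ht t0]]; first by split=> //; apply: subgroup0.
  by split; [apply: subgroupB | rewrite /= z0 t0 subrr].
have [|u [[h _] [i [[/= Hh ->]]]]|f [fD fE]] :=
    @QZ_injective X (adjoin H' (y, qz p%:R^-1)).
- exact: adjoin_subgroup.
- rewrite pairMz => -[/esym/eqP + ->]; rewrite addr_eq0 add0r => /eqP hE.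
  have Hyi : H (y *~ i) by rewrite -[_ *~ _]opprK -hE; apply: subgroupN.
  have /dvdzP[j ->] := subgroup_coprime sH pp Hy Hpy Hyi.
  apply/eqP; rewrite -qzMz qz_eq0 mulrC mulrzA -pmulrn -(mulr_natr p%:R^-1).
  by rewrite mulVf ?rpred_int // pnatr_eq0 -lt0n prime_gt0.
exists f; split=> // [h Hh|]; first by apply/fE/sub_adjoin.
by apply/fE/mem_adjoin.
Qed.

Lemma primary_step (p : nat) (X : zmodType) (H : set X) (x : X) m :
  H 0 -> ~ H x -> x *+ (p ^ m) = 0 ->
  exists k, ~ H (x *+ (p ^ k)) /\ H (x *+ (p ^ k.+1)).
Proof.
move=> H0 Hx xm; have ex_m : exists k, `[< H (x *+ (p ^ k)) >].
  by exists m; apply/asboolP; rewrite xm.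
case: (ex_minnP ex_m) => -[|k] /asboolP Hk mink; first by rewrite mulr1n in Hk.
by exists k; split=> // /asboolP/mink; rewrite ltnn.
Qed.

(** Starting from 0, subgroups are enlarged by a factor [p] at a time: either [G] is exhausted
    within [N] steps, or a subgroup of order p^(N+1) appears. The predicate [P] carries data
    attached to the elements adjoined so far. *)
Lemma primary_chain (p : nat) (X : zmodType) (G : set X)
    (P : nat -> set X -> Prop) N :
  prime p -> subgroup G -> primary p G -> P 0%N [set 0] ->
  (forall k H y, subgroup H -> H `<=` G -> G y -> ~ H y -> H (y *+ p) ->
     P k H -> P k.+1 (adjoin H y)) ->
  (exists2 l, (l <= N)%N & G #= `I_(p ^ l)) \/
  exists H, [/\ subgroup H, H `<=` G, H #= `I_(p ^ N.+1) & P N.+1 H].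
Proof.
move=> pp sG pG P0 PS; have [|nG] := pselect (exists2 l, (l <= N)%N & G #= `I_(p ^ l)).
  by left.
right; suff : forall k, (k <= N.+1)%N ->
  exists H, [/\ subgroup H, H `<=` G, H #= `I_(p ^ k) & P k H] by apply.
elim=> [_|k IHk kN].
  exists [set 0]; split=> //; last by rewrite expn0; apply: card_set1.
    by split=> // x y -> ->; rewrite subrr.
  by move=> _ ->; apply: subgroup0.
have [H [sH HG Hk PH]] := IHk (ltnW kN).
have [x Gx Hx] : exists2 x, G x & ~ H x.
  apply: contrapT => nx; apply: nG; exists k => //.
  suff <- : H = G by [].
  apply/seteqP; split=> // x Gx; apply: contrapT => Hx.
  by apply: nx; exists x.
have [m xm] := pG x Gx.
have [j [nHj Hj]] := primary_step (subgroup0 sH) Hx xm.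
(* The last p-power multiple of [x] outside [H] has order exactly [p] modulo [H]. *)
set y := x *+ (p ^ j) in nHj.
have Gy : G y by apply: subgroupMn.
have Hpy : H (y *+ p) by rewrite /y -mulrnA -expnSr.
exists (adjoin H y); split; [exact: adjoin_subgroup | exact: adjoin_sub | | exact: PS].
by rewrite expnSr; apply: card_adjoin.
Qed.

(** A chain in [T] that reached order p^(n+1) would not fit in the set [G], so [T] is exhausted
    before that. *)
Lemma primary_sub_card (p : nat) (X : zmodType) (G T : set X) n :
  prime p -> subgroup T -> primary p T -> T `<=` G -> G #= `I_(p ^ n) ->
  exists2 l, (l <= n)%N & T #= `I_(p ^ l).
Proof.
move=> pp sT pT TG Gn.
have [//|//|[H [_ HT Hn _]]] := @primary_chain p X T (fun _ _ => True) n pp sT pT I.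
have := sub_card_II (subset_trans HT TG) Hn Gn.
by rewrite leq_exp2l ?prime_gt1 // ltnn.
Qed.

(** A chain of length r + 1 in D[p] would yield elements y_i and functionals f_i whose matrix
    f_i(y_j) is triangular, with 1/p on the diagonal. Divisibility of [D] makes the f_i independent
    over the p-adic integers, against the bound on the corank. *)
Lemma divisible_tors_card (p : nat) (X : zmodType) (S D : set X) r :
  prime p -> subgroup D -> D `<=` S -> divisible D ->
  ~ corank_ge p S r.+1 -> exists2 d, (d <= r)%N & tors D p #= `I_(p ^ d).
Proof.
move=> pp sD DS dD nS; have sDp := tors_subgroup sD p.
have pDp : primary p (tors D p) by move=> x [_ xp]; exists 1%N; rewrite expn1.
pose P k (H : set X) := exists (y : nat -> X) (f : nat -> X -> QZ),
  [/\ forall i, (i < k)%N -> H (y i),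
      forall i, (i < k)%N -> forall u v, f i (u + v) = f i u + f i v,
      forall i, (i < k)%N -> f i (y i) = qz p%:R^-1 &
      forall i j, (i < k)%N -> (j < i)%N -> f i (y j) = 0].
have [|||[H [sH HD _ [y [f [yH fD fy fy0]]]]]] := @primary_chain p X _ P r pp sDp pDp.
- by exists (fun=> 0), (fun _ _ => 0).
- move=> k H y sH HD _ Hy Hpy [ys [f [yH fD fy fy0]]].
  have [g [gD gH gy]] := QZ_separation sH pp Hy Hpy.
  exists (fun i => if i == k then y else ys i), (fun i => if i == k then g else f i).
  split=> i; rewrite ltnS leq_eqVlt.
  + have [_ _|_ /= ik] := eqVneq i k; first exact: mem_adjoin.
    by apply/sub_adjoin/yH.
  + by have [_ _|_ /= ik] := eqVneq i k; [apply: gD | apply: fD].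
  + by have [_ _|_ /= ik] := eqVneq i k; [apply: gy | apply: fy].
  + move=> j; have [-> _ jk|_ /= ik ji] := eqVneq i k.
      by rewrite (ltn_eqF jk); apply/gH/yH.
    by rewrite (ltn_eqF (ltn_trans ji ik)); apply: fy0.
- by [].
case: nS; exists (fun i : 'I_r.+1 => f i); split=> [i x z _ _|]; first exact: fD.
have setT_subgroup : subgroup [set: X] by [].
have fMz (i : 'I_r.+1) x k : f i (x *~ k) = f i x *~ k.
  by apply: (additive_onMz setT_subgroup) => // u v _ _; apply: fD.
have fMn (i : 'I_r.+1) x k : f i (x *+ k) = f i x *+ k.
  by apply: (additive_onMn setT_subgroup) => // u v _ _; apply: fD.
(* Induction on the p-adic precision: once p^m divides every a_j at level m + 1, the quotients b_j
   must be shown divisible by [p]. *)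
move=> a a_padic a0 i m; elim: m i => [|m IHm] i; first by rewrite expn0 dvd1z.
have pm_dvd j : ((p ^ m)%N %| a j m.+1)%Z.
  have := a_padic j m => /eqP; rewrite eqz_mod_dvd => dj.
  by rewrite -(subrK (a j m) (a j m.+1)) rpredD.
pose b j := (a j m.+1 %/ (p ^ m)%N)%Z.
have aE j : a j m.+1 = (p ^ m)%N%:Z * b j by rewrite mulrC /b divzK.
suff pb : forall n (j : 'I_r.+1), (j < n)%N -> (p %| b j)%Z.
  by rewrite aE expnSr PoszM dvdz_mul // (pb r.+1).
(* The relation is evaluated at some z in [D] with p^m z = y_j. Terms with i > j vanish by
   triangularity, those with i < j because p divides b_i and p y_j = 0; there remains b_j / p = 0 in
   Q/Z. *)
elim=> // n IHn j; rewrite ltnS => jn.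
have [Dyj yjp] := HD _ (yH j (ltn_ord j)).
have pm_gt0 : (0 < p ^ m)%N by rewrite expn_gt0 prime_gt0.
have [z Dz zE] := dD _ _ pm_gt0 Dyj.
have := a0 z m.+1 (DS _ Dz); rewrite expnSr mulrnA zE yjp => /(_ erefl).
rewrite (bigD1 j) //= big1 => [|i' i'j].
  rewrite addr0 aE mulrzA -pmulrn -fMn zE fy // => /qz_inv_eq0; apply.
  exact: prime_gt0.
rewrite aE mulrzA -pmulrn -fMn zE.
have [i'_lt|] := ltnP i' j; last first.
  rewrite leq_eqVlt => /predU1P[/val_inj ji'|ji']; first by rewrite ji' eqxx in i'j.
  by rewrite fy0 ?mul0rz.
have /dvdzP[c ->] := IHn i' (leq_trans i'_lt jn).
by rewrite mulrC mulrzA -pmulrn -fMn yjp -[0](mulr0n 0) fMn mulr0n mul0rz.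
Qed.

(** Multiplication by p^k maps D[p^(k+1)] to D[p] with kernel D[p^k], and it is onto because [D] is
    divisible. *)
Lemma card_tors_expn (p : nat) (X : zmodType) (D : set X) d k :
  prime p -> subgroup D -> divisible D -> tors D p #= `I_(p ^ d) ->
  tors D (p ^ k) #= `I_(p ^ (d * k)).
Proof.
move=> pp sD dD Dd; elim: k => [|k IHk].
  rewrite muln0 !expn0; suff -> : tors D 1 = [set 0] by apply: card_set1.
  apply/seteqP; split=> [x [_]|x ->]; first by rewrite mulr1n.
  exact: (subgroup0 (tors_subgroup sD 1)).
rewrite mulnS addnC expnD.
have pk_gt0 : (0 < p ^ k)%N by rewrite expn_gt0 prime_gt0.
apply: (@card_ker_im _ _ _ (fun x => x *+ (p ^ k))).
- exact: tors_subgroup.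
- by move=> x y _ _; rewrite mulrnDl.
- suff -> : [set x | tors D (p ^ k.+1) x /\ x *+ (p ^ k) = 0] = tors D (p ^ k) by [].
  apply/seteqP; split=> [x [[Dx _] xk] //|x [Dx xk]].
  by split=> //; split=> //; rewrite expnSr mulrnA xk mul0rn.
- suff -> : (fun x => x *+ (p ^ k)) @` tors D (p ^ k.+1) = tors D p by [].
  apply/seteqP; split=> [_ [x [Dx xk] <-]|y [Dy yp]].
    by split; [apply: subgroupMn | rewrite -mulrnA -expnSr].
  have [x Dx xy] := dD _ _ pk_gt0 Dy.
  by exists x => //; split=> //; rewrite expnSr mulrnA xy.
Qed.

(* A surjection with kernel killed by [p ^ B] loses at most a factor
   [p ^ (d * B)] on the [p ^ k]-torsion, for every [k]. *)
Lemma tors_card_image (p : nat) (X Y : zmodType) (D : set X) (f : X -> Y) B d e :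
  prime p -> subgroup D -> divisible D -> additive_on D f ->
  (forall x, D x -> f x = 0 -> x *+ (p ^ B) = 0) ->
  tors D p #= `I_(p ^ d) -> tors (f @` D) p #= `I_(p ^ e) -> (d <= e)%N.
Proof.
move=> pp sD dD addf kerf Dd Ee.
have sE : subgroup (f @` D) by apply: (image_subgroup sD).
have dE : divisible (f @` D) by apply: (image_divisible sD).
(* The count below gives d k <= d B + e k; if e < d, this forces k <= d B, so any larger [k] gives
   the contradiction. *)
pose k := (d * B).+1.
have sDk := tors_subgroup sD (p ^ k).
have addfk : additive_on (tors D (p ^ k)) f by move=> x y [Dx _] [Dy _]; apply: addf.
have Dk := card_tors_expn k pp sD dD Dd.
have DB := card_tors_expn B pp sD dD Dd.
have Ek := card_tors_expn k pp sE dE Ee.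
have [|||l lB Kl] := @primary_sub_card p _ _
  [set x | tors D (p ^ k) x /\ f x = 0] _ pp _ _ _ DB.
- exact: ker_subgroup.
- by move=> x [[_ xk] _]; exists k.
- by move=> x [[Dx _] fx]; split; rewrite ?kerf.
have [|||j jk Ij] := @primary_sub_card p _ _ (f @` tors D (p ^ k)) _ pp _ _ _ Ek.
- exact: (image_subgroup sDk).
- by move=> _ [x [Dx xk] <-]; exists k; rewrite -(additive_onMn sD) // xk (additive_on0 sD).
- move=> _ [x [Dx xk] <-]; split; first by exists x.
  by rewrite -(additive_onMn sD) // xk (additive_on0 sD).
have := card_ker_im sDk addfk Kl Ij; rewrite -expnD => Dk'.
have /card_eq_II/eqP : `I_(p ^ (d * k)) #= `I_(p ^ (l + j)).
  by rewrite -(card_eql Dk).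
rewrite eqn_exp2l ?prime_gt1 // => /eqP dkE.
rewrite leqNgt; apply/negP => ed.
have : (d * k <= d * B + e * k)%N by rewrite dkE leq_add.
have : (e.+1 * k <= d * k)%N by rewrite leq_mul2r ed orbT.
by move=> /leq_trans le /le; rewrite mulSn leq_add2r ltnn.
Qed.

(** Induction on the exponent: p^m x lies in D[p], hence equals p^m y for some y in [E], and x - y
    has smaller exponent. *)
Lemma divisible_sub_eq (p : nat) (X : zmodType) (E D : set X) :
  prime p -> subgroup E -> subgroup D -> divisible E -> E `<=` D -> primary p D ->
  tors D p `<=` E -> D `<=` E.
Proof.
move=> pp sE sD dE ED pD DpE x Dx; have [m] := pD x Dx.
elim: m x Dx => [|m IHm] x Dx xm; first by move: xm; rewrite mulr1n => ->; apply: subgroup0.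
have pm_gt0 : (0 < p ^ m)%N by rewrite expn_gt0 prime_gt0.
have [|y Ey yx] := dE _ (x *+ (p ^ m)) pm_gt0.
  by apply: DpE; split; [apply: subgroupMn | rewrite -mulrnA -expnSr].
rewrite -(subrK y x); apply: subgroupD => //; apply: IHm.
  by apply: subgroupB => //; apply: ED.
by rewrite mulrnBl yx subrr.
Qed.

Lemma corank_ge_leq (p : nat) (X : zmodType) (S : set X) r r' :
  (r' <= r)%N -> corank_ge p S r -> corank_ge p S r'.
Proof.
move=> rr' [f [fD fI]]; exists (fun i => f (widen_ord rr' i)).
split=> [i|a a_padic a0 i]; first exact: fD.
(* A relation among the first r' functionals is padded with zero coefficients. *)
pose a' (j : 'I_r) : nat -> int := if insub (val j) is Some k then a k else fun=> 0.
have a'E k : a' (widen_ord rr' k) = a k.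
  rewrite /a' /=; case: insubP => [k' _ kk'|]; last by rewrite ltn_ord.
  by congr a; apply: val_inj.
have := fI a' _ _ (widen_ord rr' i); rewrite a'E; apply.
  by move=> j; rewrite /a'; case: insubP => [k _ _|_ m] //; apply: a_padic.
move=> x m Sx xm; rewrite -[RHS](a0 x m Sx xm).
rewrite (bigID (fun j : 'I_r => (j < r')%N)) /= [X in _ + X]big1 ?addr0.
  by rewrite big_ord_narrow; apply: eq_bigr => k _; rewrite a'E.
by move=> j jr'; rewrite /a' insubN // mulr0z.
Qed.

Lemma is_corank_uniq (p : nat) (X : zmodType) (S : set X) r r' :
  is_corank p S r -> is_corank p S r' -> r = r'.
Proof.
move=> [Sr nSr] [Sr' nSr']; case: (ltngtP r r') => // rr'.
  by case: nSr; apply: corank_ge_leq rr' _.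
by case: nSr'; apply: corank_ge_leq rr' _.
Qed.

(* [p ^ B] times a functional on [S] factors through [f], and extends from the
   image of [f] because Q/Z is injective. *)
Lemma corank_ge_image (p : nat) (X Y : zmodType) (S : set X) (T : set Y)
    (f : X -> Y) B r :
  prime p -> subgroup S -> additive_on S f -> (forall x, S x -> T (f x)) ->
  (forall x, S x -> f x = 0 -> x *+ (p ^ B) = 0) ->
  corank_ge p S r -> corank_ge p T r.
Proof.
move=> pp sS addf fT kerf [g [gD gI]].
have [h hP] : exists h : 'I_r -> Y -> QZ, forall i,
    (forall u v, h i (u + v) = h i u + h i v) /\
    (forall x, S x -> h i (f x) = g i x *+ (p ^ B)).
  suff /choice[h hP] : forall i, exists h : Y -> QZ,
    (forall u v, h (u + v) = h u + h v) /\
    (forall x, S x -> h (f x) = g i x *+ (p ^ B)) by exists h.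
  move=> i; pose G : set (Y * QZ)%type :=
    [set z | exists2 x, S x & z = (f x, g i x *+ (p ^ B))].
  have [||h [hD hG]] := @QZ_injective Y G.
  - split.
      exists 0; first exact: subgroup0.
      by rewrite (additive_on0 sS addf) (additive_on0 sS (gD i)) mul0rn.
    move=> _ _ [x Sx ->] [y Sy ->]; exists (x - y); first exact: subgroupB.
    by rewrite (additive_onB sS addf) // (additive_onB sS (gD i)) // mulrnBl.
  - move=> u [x Sx [/esym/(kerf x Sx) xB ->]].
    by rewrite -(additive_onMn sS (gD i)) // xB (additive_on0 sS (gD i)).
  by exists h; split=> // x Sx; apply: hG; exists x.
exists h; split=> [i u v _ _|a a_padic a0 i m]; first exact: (hP i).1.
(* As [h i] pulls back to p^B times [g i], a relation among the [h i] with coefficients [a] is one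
   among the [g i] with coefficients p^B a. *)
have aB k : ((p ^ k)%N %| a i k * (p ^ B)%N)%Z.
  apply: (gI (fun i k => a i k * (p ^ B)%N%:Z)) => [j n|x n Sx xn].
    by apply/eqP; rewrite eqz_mod_dvd -mulrBl dvdz_mulr // -eqz_mod_dvd; apply/eqP/a_padic.
  rewrite -[RHS](a0 (f x) n (fT _ Sx)).
    by apply: eq_bigr => j _; rewrite (hP j).2 // mulrC mulrzA -pmulrn.
  by rewrite -(additive_onMn sS addf) // xn (additive_on0 sS addf).
have aD k : ((p ^ m)%N %| a i (m + k)%N - a i m)%Z.
  elim: k => [|k IHk]; first by rewrite addn0 subrr.
  rewrite -(subrK (a i (m + k)%N) (a i (m + k.+1)%N)) -addrA rpredD //.
  have /eqP := a_padic i (m + k)%N; rewrite eqz_mod_dvd addnS => dk.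
  by apply: dvdz_trans dk; rewrite dvdzE dvdn_exp2l ?leq_addr.
(* Dividing by p^B costs [B] levels of precision: level m + B shows that p^m divides a(m + B), which
   is congruent to a(m) modulo p^m. *)
have := aB (m + B)%N; rewrite expnD PoszM dvdz_mul2r.
  by move=> aBm; have := rpredB aBm (aD B); rewrite opprB addrC subrK.
by rewrite eqz_nat -lt0n expn_gt0 prime_gt0.
Qed.

End PrimaryGroups.

(** * Towers of divisible groups *)

Section DivisibleTowers.
Local Open Scope classical_set_scope.
Local Open Scope card_scope.
Local Open Scope ring_scope.

Lemma maxdiv_sub (X : zmodType) (S : set X) : maxdiv S `<=` S.
Proof. by move=> x [D [DS _ _ /DS]]. Qed.

Lemma maxdiv_divisible (X : zmodType) (S : set X) : divisible (maxdiv S).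
Proof.
move=> n x n0 [D [DS sD dD Dx]]; have [y Dy yx] := dD n x n0 Dx.
by exists y => //; exists D.
Qed.

Lemma maxdiv_subgroup (X : zmodType) (S : set X) :
  subgroup S -> subgroup (maxdiv S).
Proof.
move=> sS; split.
  exists [set 0]; split=> // [_ ->|| n x n0 ->]; first exact: subgroup0.
    by split=> // x y -> ->; rewrite subrr.
  by exists 0; rewrite ?mul0rn.
move=> x y [D [DS sD dD Dx]] [E [ES sE dE Ey]].
exists [set z | exists u v, [/\ D u, E v & z = u - v]].
split=> [_ [u [v [/DS Su /ES Sv ->]]]|||]; first exact: subgroupB; last by exists x, y.
  split; first by exists 0, 0; split; rewrite ?subrr //; apply: subgroup0.
  move=> _ _ [u [v [Du Ev ->]]] [u' [v' [Du' Ev' ->]]].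
  by exists (u - u'), (v - v'); rewrite subBACA; split=> //; apply: subgroupB.
move=> n _ n0 [u [v [Du Ev ->]]].
have [[u' Du' <-] [v' Ev' <-]] := (dD n u n0 Du, dE n v n0 Ev).
by exists (u' - v'); rewrite ?mulrnBl //; exists u', v'.
Qed.

Lemma maxdiv_image (X Y : zmodType) (S : set X) (T : set Y) (f : X -> Y) x :
  subgroup S -> additive_on S f -> (forall x, S x -> T (f x)) ->
  maxdiv S x -> maxdiv T (f x).
Proof.
move=> sS addf fT [D [DS sD dD Dx]]; exists (f @` D).
split; [by move=> _ [z /DS/fT Tz <-] | | | by exists x].
  exact: (image_subgroup sS).
exact: (image_divisible sS).
Qed.

Lemma eventually_constant (u : nat -> nat) b :
  (forall m n, (m <= n)%N -> (u m <= u n)%N) -> (forall n, (u n <= b)%N) ->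
  exists n0, forall n, (n0 <= n)%N -> u n = u n0.
Proof.
move=> u_mono u_le; have ex_v : exists v, `[< exists n, u n = v >].
  by exists (u 0%N); apply/asboolP; exists 0%N.
have v_le v : `[< exists n, u n = v >] -> (v <= b)%N.
  by move=> /asboolP[n <-].
case: (ex_maxnP ex_v v_le) => v /asboolP[n0 <-] max_v; exists n0 => n n0n.
apply/eqP; rewrite eqn_leq (u_mono n0 n) // andbT max_v //.
by apply/asboolP; exists n.
Qed.

Variables (p : nat) (X : nat -> zmodType) (S : forall n, set (X n)).
Variables (rho : forall n n', X n -> X n') (B : nat).
Hypothesis pp : prime p.
Hypothesis sS : forall n, subgroup (@S n).
Hypothesis pS : forall n, primary p (@S n).
Hypothesis rhoD : forall n n', (n <= n')%N -> additive_on (@S n) (@rho n n').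
Hypothesis rhoS : forall n n', (n <= n')%N -> forall x, S x -> S (@rho n n' x).
Hypothesis rho_comp : forall n n' n'', (n <= n')%N -> (n' <= n'')%N ->
  forall x, S x -> @rho n' n'' (@rho n n' x) = @rho n n'' x.
Hypothesis rho_ker : forall n n', (n <= n')%N -> forall x, S x ->
  @rho n n' x = 0 -> x *+ (p ^ B) = 0.
Hypothesis corank_bounded :
  exists b, forall n, exists2 r, is_corank p (@S n) r & (r <= b)%N.

Let D n := maxdiv (@S n).
Let sD n : subgroup (@D n) := maxdiv_subgroup (@sS n).
Let dD n : divisible (@D n) := maxdiv_divisible (S := @S n).
Let DS n : @D n `<=` @S n := @maxdiv_sub _ _.

Let rhoDD n n' : (n <= n')%N -> additive_on (@D n) (@rho n n').
Proof. by move=> nn' x y /DS Sx /DS Sy; apply: rhoD. Qed.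

Let rho_maxdiv n n' : (n <= n')%N -> forall x, D x -> D (@rho n n' x).
Proof.
by move=> nn' x; apply: maxdiv_image; [apply: sS | apply: rhoD | apply: rhoS].
Qed.

Lemma tower_corank :
  exists r n0, forall n, (n0 <= n)%N -> is_corank p (@S n) r.
Proof.
have [b hb] := corank_bounded.
have /choice[r rP] : forall n, exists r, is_corank p (@S n) r /\ (r <= b)%N.
  by move=> n; have [r] := hb n; exists r.
have r_mono m n : (m <= n)%N -> (r m <= r n)%N.
  move=> mn; rewrite leqNgt; apply/negP => nm.
  have [[Sm _] _] := rP m; have [[_ nSn] _] := rP n; apply: nSn.
  apply: (corank_ge_image pp (@sS m) (rhoD mn) (rhoS mn) (rho_ker mn)).
  exact: corank_ge_leq nm _.
have [n0 rE] := eventually_constant r_mono (fun n => (rP n).2).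
by exists (r n0), n0 => n /rE <-; exact: (rP n).1.
Qed.

(** The uniform bound [b] serves to make [d] eventually constant; the bound by the corank of the
    same layer gives the factor [r] in the final estimate. *)
Let tower_dim : exists b (d : nat -> nat), forall n,
  [/\ tors (@D n) p #= `I_(p ^ d n), (d n <= b)%N &
      forall r, is_corank p (@S n) r -> (d n <= r)%N].
Proof.
have [b hb] := corank_bounded; exists b.
suff /choice[d dP] : forall n, exists d, [/\ tors (@D n) p #= `I_(p ^ d), (d <= b)%N &
  forall r, is_corank p (@S n) r -> (d <= r)%N] by exists d.
move=> n; have [r [Sr nSr] rb] := hb n.
have [d dr Dd] := divisible_tors_card pp (@sD n) (@DS n) (@dD n) nSr.
exists d; split=> // [|r' Sr']; first exact: leq_trans dr rb.
by rewrite (is_corank_uniq Sr' (conj Sr nSr)).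
Qed.

(** The lower bound holds because the kernel has bounded exponent, the upper one by inclusion. When
    d = d' the image is squeezed to the full p-torsion. *)
Let image_dim n n' d d' : (n <= n')%N ->
  tors (@D n) p #= `I_(p ^ d) -> tors (@D n') p #= `I_(p ^ d') ->
  exists e, [/\ tors (@rho n n' @` @D n) p #= `I_(p ^ e), (d <= e)%N & (e <= d')%N].
Proof.
move=> nn' Dd Dd'.
have sE : subgroup (@rho n n' @` @D n).
  by apply: (image_subgroup (sD n)) => //; apply: rhoDD.
have [|||e ed' Ee] := @primary_sub_card p _ _ (tors (@rho n n' @` @D n) p) _ pp _ _ _ Dd'.
- exact: tors_subgroup.
- by move=> x [_ xp]; exists 1%N; rewrite expn1.
- by move=> _ [[x Dx <-] xp]; split=> //; apply: rho_maxdiv.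
exists e; split=> //; apply: (tors_card_image pp (sD n) (dD (n := n)) (rhoDD nn') _ Dd Ee).
by move=> x /DS; apply: rho_ker.
Qed.

Theorem tower_iso : exists n0, forall n n', (n0 <= n)%N -> (n <= n')%N ->
  group_iso (@D n) (@D n') (@rho n n').
Proof.
have [b [d dP]] := tower_dim.
have d_mono m n : (m <= n)%N -> (d m <= d n)%N.
  move=> mn; have [[Dm _ _] [Dn _ _]] := (dP m, dP n).
  by have [e [_ de]] := image_dim mn Dm Dn; apply: leq_trans.
have d_le n : (d n <= b)%N by have [] := dP n.
have [n1 dE] := eventually_constant d_mono d_le.
have rho_surj n n' : (n1 <= n)%N -> (n <= n')%N -> @D n' `<=` @rho n n' @` @D n.
  move=> n1n nn'; have [[Dn _ _] [Dn' _ _]] := (dP n, dP n').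
  have [e [Ee de ed']] := image_dim nn' Dn Dn'.
  have ee : e = d n'.
    by apply/eqP; rewrite eqn_leq ed' dE ?(leq_trans n1n) // -(dE n n1n).
  rewrite ee in Ee; have subE : @rho n n' @` @D n `<=` @D n'.
    by move=> _ [x Dx <-]; apply: rho_maxdiv.
  apply: (divisible_sub_eq pp) => //.
  - by apply: (image_subgroup (sD n)) => //; apply: rhoDD.
  - by apply: (image_divisible (sD n)) => //; apply: rhoDD.
  - by move=> x /DS; apply: pS.
  - rewrite -(sub_card_eq_II _ Ee Dn') => [x []//|x [Ex xp]].
    by split=> //; apply: subE.
(* Kernels are compared inside the single group at level [n1]; by surjectivity every element of a
   later divisible group comes from there. *)
pose K n : set (X n1) := [set x | D x /\ @rho n1 n x = 0].
have [k kP] : exists k, forall n, (n1 <= n)%N ->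
    K n #= `I_(p ^ k n) /\ (k n <= d n1 * B)%N.
  suff /choice[k kP] : forall n, exists k, (n1 <= n)%N ->
    K n #= `I_(p ^ k) /\ (k <= d n1 * B)%N by exists k.
  move=> n; have [n1n|nn1] := leqP n1 n; last by exists 0%N.
  have [Dn1 _ _] := dP n1.
  have [|||l lB Kl] := @primary_sub_card p _ _ (K n) _ pp _ _ _
      (card_tors_expn B pp (sD n1) (dD (n := n1)) Dn1); last by exists l.
  - exact: (ker_subgroup (sD n1) (rhoDD n1n)).
  - by move=> x [/DS Sx _]; apply: pS.
  - by move=> x [Dx rx]; split=> //; apply: (rho_ker n1n) rx; apply: DS.
have K_mono m n : (n1 <= m)%N -> (m <= n)%N -> K m `<=` K n.
  move=> n1m mn x [Dx rx]; split=> //; have Sx := DS Dx.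
  by rewrite -(rho_comp n1m mn) // rx (additive_on0 (sS m) (rhoD mn)).
have [|n|n0 kE] := @eventually_constant (fun n => k (n1 + n)%N) (d n1 * B).
- move=> m n mn; have n1m : (n1 <= n1 + m)%N by apply: leq_addr.
  have n1n : (n1 <= n1 + n)%N by apply: leq_addr.
  have mn' : (n1 + m <= n1 + n)%N by rewrite leq_add2l.
  rewrite -(leq_exp2l _ _ (prime_gt1 pp)).
  exact: sub_card_II (K_mono _ _ n1m mn') (kP _ n1m).1 (kP _ n1n).1.
- by have [] := kP (n1 + n)%N (leq_addr _ _).
have {}kE n : (n1 + n0 <= n)%N -> k n = k (n1 + n0)%N.
  move=> n0n; have n1n : (n1 <= n)%N by apply: leq_trans n0n; apply: leq_addr.
  by rewrite -(subnKC n1n) kE // leq_subRL.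
exists (n1 + n0)%N => n n' n0n nn'.
have n1n : (n1 <= n)%N by apply: leq_trans n0n; apply: leq_addr.
have n1n' := leq_trans n1n nn'.
have KE : K n = K n'.
  apply: (sub_card_eq_II (K_mono _ _ n1n nn') (kP _ n1n).1).
  by rewrite kE // -(kE n') ?(leq_trans n0n) //; exact: (kP _ n1n').1.
split=> [x y Dx Dy|]; first exact: rhoDD.
split; [by move=> x; apply: rho_maxdiv| | exact: rho_surj].
move=> x y /set_mem Dx /set_mem Dy.
apply: (additive_on_inj (sD n) (rhoDD nn')) => //= {x y Dx Dy} x Dx rx.
(* An [x] killed at level n' is the image of some [y] of level [n1] lying in [K n'], which equals
   [K n]; hence x = 0. *)
have [y Dy yx] := rho_surj n1 n (leqnn _) n1n x Dx.
have [] : K n y by rewrite KE; split=> //; rewrite -(rho_comp n1n nn') ?yx //; apply: DS.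
by rewrite yx.
Qed.

Theorem tower_tors_card (T : forall n, set (X n)) a :
  (forall n, subgroup (@T n)) -> (forall n, @T n `<=` tors (@D n) (p ^ a)) ->
  (forall n n', (n <= n')%N -> forall x, T n x -> T n' (rho n' x)) ->
  exists r lambda,
    [/\ exists n0, forall n, (n0 <= n)%N -> is_corank p (@S n) r,
        (lambda <= a * r)%N &
        exists n0, forall n, (n0 <= n)%N -> @T n #= `I_(p ^ lambda)].
Proof.
move=> sT TD rhoT; have [r [n1 rE]] := tower_corank; exists r.
have [n2 isoP] := tower_iso.
have [b [d dP]] := tower_dim.
have [l lP] : exists l, forall n, (l n <= d n * a)%N /\ @T n #= `I_(p ^ l n).
  suff /choice[l lP] : forall n, exists l, (l <= d n * a)%N /\ @T n #= `I_(p ^ l).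
    by exists l.
  move=> n; have [Dn _ _] := dP n.
  have [|l ln Tl] := primary_sub_card pp (sT n) _ (@TD n)
    (card_tors_expn a pp (sD n) (dD (n := n)) Dn); last by exists l.
  by move=> x /TD[/DS Sx _]; apply: pS.
(* [l] grows because [rho] is injective on the divisible groups, which is known only from [n2] on;
   hence the shift of the index. *)
have [|n|n3 lE] := @eventually_constant (fun n => l (n2 + n)%N) (b * a).
- move=> m n mn; have mn' : (n2 + m <= n2 + n)%N by rewrite leq_add2l.
  have [_ [_ rinj _]] := isoP _ _ (leq_addr m n2) mn'.
  rewrite -(leq_exp2l _ _ (prime_gt1 pp)).
  have TTm : T (n2 + m)%N `<=` @D (n2 + m)%N by move=> x /TD[].
  rewrite -card_le_II -(card_le_eql (lP _).2) -(card_le_eqr (lP _).2).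
  have /card_le_eql <- : @rho (n2 + m)%N (n2 + n)%N @` T (n2 + m)%N #= T (n2 + m)%N.
    apply: inj_card_eq => x y /set_mem/TTm Dx /set_mem/TTm Dy.
    by apply: rinj; rewrite inE.
  by apply: subset_card_le => _ [x Tx <-]; apply: rhoT.
- have [ln _] := lP (n2 + n)%N; apply: leq_trans ln _.
  by rewrite leq_mul2r; have [_ -> _] := dP (n2 + n)%N; rewrite orbT.
exists (l (n2 + n3)%N); split; first by exists n1.
  (* The constant value is read at an index that is also past [n1], where the corank is already [r]
     and bounds [d]. *)
  rewrite -(lE (n1 + n3)%N) ?leq_addl // mulnC.
  have [ln _] := lP (n2 + (n1 + n3))%N; apply: leq_trans ln _.
  rewrite leq_mul2r; have [_ _ dr] := dP (n2 + (n1 + n3))%N.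
  by rewrite dr ?orbT //; apply: rE; rewrite addnCA leq_addr.
exists (n2 + n3)%N => n n3n.
have n2n : (n2 <= n)%N by apply: leq_trans n3n; apply: leq_addr.
by rewrite -(lE (n - n2)%N) ?leq_subRL // subnKC //; exact: (lP n).2.
Qed.

End DivisibleTowers.

(** * Galois descent *)

Section GaloisDescent.
Local Open Scope classical_set_scope.
Local Open Scope card_scope.
Local Open Scope ring_scope.

(** Adjoining all roots of the product of the minimal polynomials, and not only the elements of [s],
    makes the field normal over Q. *)
Lemma splitting_num_field_exists (s : seq algC) :
  exists (Qs : splittingFieldType rat) (QsC : {rmorphism Qs -> algC}),
    forall x, x \in s -> exists u, QsC u = x.
Proof.
pose mp (x : algC) := s2val (minCpolyP x).
pose q : {poly rat} := \prod_(x <- s) mp x.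
have [r qr] := closed_field_poly_normal (map_poly (@ratr algC) q).
have q_monic : q \is monic.
  by apply: monic_prod => x _; rewrite /mp; case: (minCpolyP x) => ? [].
have {qr} : map_poly (@ratr algC) q = \prod_(z <- r) ('X - z%:P).
  by rewrite [LHS]qr lead_coef_map (monicP q_monic) rmorph1 scale1r.
have [Qs [QsC [s1 <- s1gen]]] := num_field_exists r => qE.
have s1E : map_poly (in_alg Qs) q = \prod_(u <- s1) ('X - u%:P).
  apply: (map_inj_poly (fmorph_inj QsC) (rmorph0 QsC)).
  rewrite -map_poly_comp (eq_map_poly (g := @ratr algC)) => [|c /=].
    rewrite qE big_map rmorph_prod; apply: eq_bigr => u _ /=.
    by rewrite rmorphB /= map_polyX map_polyC.
  by rewrite rmorphZ_num rmorph1 mulr1.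
have split_ax : SplittingField.axiom Qs.
  exists (map_poly (in_alg Qs) q); first exact: alg_polyOver.
  by exists s1; rewrite // s1E eqpxx.
pose Qs' : splittingFieldType rat :=
  HB.pack_for (splittingFieldType rat) (Falgebra.sort Qs)
    (FieldExt_isSplittingField.Build _ Qs split_ax).
exists Qs', QsC => x xs.
have : root (map_poly (@ratr algC) q) x.
  rewrite /q (big_rem x xs) rmorphM rootM; apply/orP; left.
  by rewrite /mp; case: (minCpolyP x) => m /= [<- _ _]; rewrite root_minCpoly.
by rewrite qE root_prod_XsubC => /mapP[u _ ->]; exists u.
Qed.

(** A subspace of maximal dimension inside [P] contains every vector of [P], since adding one cannot
    raise the dimension. This turns a mere predicate into a subspace to which Galois theory
    applies. *)
Lemma vspace_of_submod (F : fieldType) (V : vectType F) (P : V -> Prop) :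
  P 0 -> (forall a u v, P u -> P v -> P (a *: u + v)) ->
  exists U : {vspace V}, forall u, u \in U <-> P u.
Proof.
move=> P0 PD; pose dims d := `[< exists2 U : {vspace V},
  forall u, u \in U -> P u & \dim U = d >].
have ex_d : exists d, dims d.
  exists 0%N; apply/asboolP; exists 0%VS; last by rewrite dimv0.
  by move=> u; rewrite memv0 => /eqP->.
have d_le d : dims d -> (d <= \dim {:V})%N.
  by move=> /asboolP[U _ <-]; rewrite dimvS ?subvf.
case: (ex_maxnP ex_d d_le) => d /asboolP[U UP <-] max_d.
exists U => u; split=> [|Pu]; first exact: UP.
have : (\dim (U + <[u]>) <= \dim U)%N.
  apply: max_d; apply/asboolP; exists (U + <[u]>)%VS => //.
  move=> _ /memv_addP[v Uv [_ /vlineP[a ->] ->]].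
  by rewrite addrC; apply: PD => //; apply: UP.
rewrite (geq_leqif (dimv_leqif_sup (addvSl U <[u]>))) => /subvP; apply.
by apply: (subvP (addvSr U <[u]>)); apply: memv_line.
Qed.

(** [F] and [y] are placed in a finite normal extension [Qs] of Q, where the finite Galois
    correspondence over the subfield [M] given by [F] applies. *)
Lemma numField_fixed (F : numField) (y : algC) :
  (forall sigma : Aut, in_gal F sigma -> sigma y = y) -> y \in F.
Proof.
move=> fix_y; have [s sP] := nf_findim F.
have [Qs [QsC sQ]] := splitting_num_field_exists (y :: s).
have [|v vE] := sQ y; first by rewrite mem_head.
have FQ x : x \in F -> exists u, QsC u = x.
  move=> /sP[c ->]; have /choice[t tP] i : exists u, QsC u = s`_i.
    have [si|si] := ltnP i (size s); last by exists 0; rewrite rmorph0 nth_default.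
    by apply: sQ; rewrite in_cons mem_nth ?orbT.
  exists (\sum_i c i *: t (nat_of_ord i)); rewrite rmorph_sum.
  by apply: eq_bigr => i _; rewrite rmorphZ_num tP.
have [||U UP] := @vspace_of_submod _ Qs (fun u => QsC u \in F).
- by rewrite rmorph0 rpred0.
- move=> a u w Fu Fw; rewrite rmorphD rmorphZ_num; apply: rpredD => //.
  by apply: rpredM => //; apply: rpred_rat.
have aU : is_aspace U.
  rewrite /is_aspace has_algid1; last by apply/UP; rewrite rmorph1 rpred1.
  by apply/prodvP => u w /UP Fu /UP Fw; apply/UP; rewrite rmorphM rpredM.
pose M := ASpace aU.
have galM : galois M {:Qs}.
  apply/and3P; split; [exact: subvf | | exact: normalFieldf].
  apply/separableP => u _; apply: pcharf0_separable => i.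
  by rewrite pchar_lalg pchar_num.
suff : v \in M by move=> /UP; rewrite vE.
have /galois_fixedField fixM := galM.
suff : v \in fixedField 'Gal({:Qs} / M)%g by rewrite fixM.
apply/fixedFieldP; first exact: memvf.
move=> g galg; apply: (fmorph_inj QsC).
(* Each [g] fixing [M] extends to an automorphism of [algC]; the extension fixes [F], which lies in
   the image of [M]. *)
have [nu nuE] := extend_algC_subfield_aut QsC (g : {rmorphism Qs -> Qs}).
rewrite nuE vE fix_y // => x Fx; have [u uE] := FQ x Fx.
rewrite -uE -nuE; congr (QsC _).
apply: (fixed_gal _ galg); [exact: subvf | by apply/UP; rewrite uE].
Qed.

Lemma proj_map_comp (L L' L'' : fieldType) (h : {rmorphism L -> L'})
    (h' : {rmorphism L' -> L''}) (h'' : {rmorphism L -> L''}) N (x : proj L N) :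
  h' \o h =1 h'' -> proj_map h' (proj_map h x) = proj_map h'' x.
Proof.
move=> hE; apply/proj_eqP; apply/eqmxP.
apply: eqmx_trans (pvec_proj_map _ _) _.
apply: eqmx_trans _ (eqmx_sym (pvec_proj_map _ _)).
have -> : map_mx h'' (pvec x) = map_mx h' (map_mx h (pvec x)).
  by apply/rowP => j; rewrite !mxE -hE.
apply/eqmxP; rewrite !map_submx.
by apply/eqmxP; apply: pvec_proj_map.
Qed.

(** Scaling one coordinate to 1 removes the scalar ambiguity: a fixed line then has a fixed
    representative, whose coordinates descend one by one. *)
Lemma proj_fixed_rational (F : numField) N (x : proj algC N) :
  (forall sigma : Aut, in_gal F sigma -> proj_map sigma x = x) ->
  exists2 v : 'rV[algC]_N, forall j, v 0 j \in F & (v == pvec x)%MS.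
Proof.
move=> fix_x; have [i xi] : exists i, pvec x 0 i != 0.
  apply: contrapT => nx; case/negP: (pvec_neq0 x); apply/eqP/rowP => i.
  by rewrite mxE; apply/eqP/negP => /negP xi; apply: nx; exists i.
pose v := (pvec x 0 i)^-1 *: pvec x.
have vi : v 0 i = 1 by rewrite mxE mulVf.
have vx : (v :=: pvec x)%MS by apply: eqmx_scale; rewrite invr_eq0.
exists v => [j|]; last exact/eqmxP.
apply: numField_fixed => sigma sF.
have : (map_mx sigma v == v)%MS.
  apply/eqmxP; apply: eqmx_trans _ (eqmx_sym vx); rewrite -[in X in (_ :=: X)%MS](fix_x _ sF).
  apply: eqmx_trans _ (eqmx_sym (pvec_proj_map _ _)).
  by apply/eqmxP; rewrite !map_submx; apply/eqmxP.
have v0 : map_mx sigma v != 0.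
  by rewrite map_mx_eq0 scaler_eq0 invr_eq0 (negPf xi) (negPf (pvec_neq0 x)).
move=> /(eqmx_scaleP v0)[a a0 vE].
have a1 : a = 1.
  by have := congr1 (fun w : 'rV_N => w 0 i) vE; rewrite mxE vi rmorph1 mxE vi mulr1 => <-.
by have := congr1 (fun w : 'rV_N => w 0 j) vE; rewrite a1 scale1r mxE.
Qed.

End GaloisDescent.

(** * Galois cohomology *)

Section Cohomology.
Import Quotient.
Local Open Scope classical_set_scope.
Local Open Scope card_scope.
Local Open Scope ring_scope.
Local Open Scope quotient_scope.

Lemma pt_map_comp (K : numField) (A : abVar K) (L L' L'' : fieldType)
    (i : {rmorphism algC -> L}) (i' : {rmorphism algC -> L'})
    (i'' : {rmorphism algC -> L''}) (h : {rmorphism L -> L'})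
    (h' : {rmorphism L' -> L''}) (h'' : {rmorphism L -> L''})
    (x : avpts A i) :
  {in K, h \o i =1 i'} -> {in K, h' \o i' =1 i''} -> h' \o h =1 h'' ->
  pt_map i'' h' (pt_map i' h x) = pt_map i'' h'' x.
Proof.
move=> hK h'K hE; apply: val_inj; rewrite !val_pt_map ?(proj_map_comp _ hE) //.
by move=> y Ky; have /= e := hK y Ky; rewrite /= -(hE (i y)) /= e; apply: h'K.
Qed.

Lemma gactM (K : numField) (A : abVar K) (F : finExt K) (sigma tau : Aut)
    (x : gavpts A) : in_gal F sigma -> in_gal F tau ->
  gact (sigma \o tau : Aut) x = gact sigma (gact tau x).
Proof.
by move=> /in_gal_ext sK /in_gal_ext tK; apply/esym/pt_map_comp.
Qed.

Lemma gact_ext (K : numField) (A : abVar K) (F : finExt K) (sigma tau : Aut)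
    (x : gavpts A) : in_gal F sigma -> sigma =1 tau -> gact sigma x = gact tau x.
Proof.
move=> sF st; have tF : in_gal F tau by move=> y Fy; rewrite -st sF.
apply: val_inj; rewrite /gact (val_pt_map _ (in_gal_ext sF)).
rewrite (val_pt_map _ (in_gal_ext tF)).
apply/proj_eqP/eqmxP; apply: eqmx_trans (pvec_proj_map _ _) _.
apply: eqmx_trans _ (eqmx_sym (pvec_proj_map _ _)).
by rewrite (eq_map_mx _ st).
Qed.

Lemma in_gal_comp (F : {pred algC}) (sigma tau : Aut) :
  in_gal F sigma -> in_gal F tau -> in_gal F (sigma \o tau : Aut).
Proof. by move=> sF tF x Fx; rewrite /= tF ?sF. Qed.

Lemma gact0 (K : numField) (A : abVar K) (F : finExt K) sigma :
  in_gal F sigma -> gact sigma (0 : gavpts A) = 0.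
Proof. by move=> /in_gal_ext sK; exact: (pt_map0 sK). Qed.

Lemma gactMn (K : numField) (A : abVar K) (F : finExt K) sigma (x : gavpts A) n :
  in_gal F sigma -> gact sigma (x *+ n) = gact sigma x *+ n.
Proof.
move=> /in_gal_ext sK; apply: (@additive_onMn _ setT) => // u v _ _.
exact: (pt_mapD sK).
Qed.

(* An element equal to a multiple [p ^ k] of itself with [k > 0] is zero, so that
   the elements [x *+ p ^ i] are pairwise distinct until they vanish. *)
Lemma tors_card_exponent (X : zmodType) (T : set X) (p B m : nat) (x : X) :
  T #<= `I_B -> (forall i, T (x *+ (p ^ i))) -> x *+ (p ^ m) = 0 ->
  x *+ (p ^ B) = 0.
Proof.
move=> TB Tx xm; apply: contrapT => xB.
have key i j : (i < j)%N -> (j <= B)%N -> x *+ (p ^ i) = x *+ (p ^ j) -> False.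
  move=> ij jB e; apply: xB; rewrite -(subnKC (leq_trans (ltnW ij) jB)).
  apply: mulrn_pow0; set z := x *+ (p ^ i) in e *.
  have zE1 : z *+ (p ^ (j - i)) = z.
    by rewrite {1}/z -mulrnA -expnD subnKC ?e // ltnW.
  have zE k : z = z *+ (p ^ (k * (j - i))).
    elim: k => [|k IHk]; first by rewrite mul0n mulr1n.
    by rewrite mulSn expnD mulrnA zE1 -IHk.
  rewrite (zE m) /z -mulrnA mulnC mulrnA.
  suff -> : x *+ (p ^ (m * (j - i))) = 0 by rewrite mul0rn.
  rewrite -(subnKC (leq_pmulr m _ : (m <= m * (j - i))%N)) ?subn_gt0 //.
  exact: mulrn_pow0.
suff : (B < B)%N by rewrite ltnn.
rewrite -card_le_II; apply: card_le_trans TB.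
have eI : (fun i => x *+ (p ^ i)) @` `I_B.+1 #= `I_B.+1.
  apply: inj_card_eq => i j /set_mem /= iB /set_mem /= jB e.
  by case: (ltngtP i j) => // ij; [case: (key i j) | case: (key j i)].
by rewrite -(card_le_eql eI); apply: subset_card_le => _ [i _ <-].
Qed.

Section Classes.
Variables (K : numField) (A : abVar K) (p : nat).
Implicit Types F : finExt K.

Lemma h1_classB F (c c' : cocycles A p F) :
  h1_class (c - c') = h1_class c - h1_class c'.
Proof. exact: (raddfB (\pi_{quot (B1 A p F)})). Qed.

Lemma h1_classD F (c c' : cocycles A p F) :
  h1_class (c + c') = h1_class c + h1_class c'.
Proof. exact: (raddfD (\pi_{quot (B1 A p F)})). Qed.

Lemma h1_class0 F : h1_class (0 : cocycles A p F) = 0.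
Proof. by rewrite -(subrr 0) h1_classB subrr. Qed.

Lemma h1_classMn F (c : cocycles A p F) n : h1_class (c *+ n) = h1_class c *+ n.
Proof. exact: (raddfMn (\pi_{quot (B1 A p F)})). Qed.

Lemma val_cocyclesMn F (c : cocycles A p F) n sigma :
  val (c *+ n) sigma = val c sigma *+ n.
Proof. by rewrite (raddfMn val); elim: n => // n IHn; rewrite !mulrS -IHn. Qed.

Lemma h1_class_eq0 F (c : cocycles A p F) :
  h1_class c = 0 <-> exists m, coboundary p m F (val c).
Proof.
rewrite -(h1_class0 F) h1_classP.
suff -> : (fun sigma => val c sigma - val (0 : cocycles A p F) sigma) = val c by [].
by apply/funext => sigma; rewrite -val_cocyclesB subr0.
Qed.

Lemma h1_primary F (x : H1 A p F) : exists m, x *+ (p ^ m) = 0.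
Proof.
rewrite -(h1_reprK x); have /asboolP[m [cp _ _]] := valP (h1_repr x).
exists m; rewrite -h1_classMn; apply/h1_class_eq0; exists 0%N, 0 => [|sigma sF].
  by rewrite mul0rn.
by rewrite val_cocyclesMn cp // (gact0 _ sF) subrr.
Qed.

Section Restriction.
Variables F F' : finExt K.
Hypothesis FF' : {subset F <= F'}.

Lemma in_galS (sigma : Aut) : in_gal F' sigma -> in_gal F sigma.
Proof. by move=> sF' x /FF'; apply: sF'. Qed.

Lemma Z1_res (c : cocycles A p F) : val c \in Z1 A p F'.
Proof.
have /asboolP[m [dp dM dC]] := valP c; apply/asboolP; exists m.
split=> [sigma /in_galS sF|sigma tau /in_galS sF /in_galS tF|sigma /in_galS sF].
- exact: dp.
- exact: dM.
by have [s ds] := dC _ sF; exists s => tau /in_galS; apply: ds.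
Qed.

(** A form of restriction with no default value, which replaces the [insubd] of [h1_res] once [F] is
    known to lie in [F']. *)
Definition cocycle_res (c : cocycles A p F) : cocycles A p F' :=
  exist (fun c => c \in Z1 A p F') (val c) (Z1_res c).

Lemma h1_res_class (c : cocycles A p F) :
  h1_res A p F F' (h1_class c) = h1_class (cocycle_res c).
Proof. exact: h1_resE. Qed.

Lemma h1_resD (x y : H1 A p F) :
  h1_res A p F F' (x + y) = h1_res A p F F' x + h1_res A p F F' y.
Proof.
rewrite -(h1_reprK x) -(h1_reprK y); move: (h1_repr x) (h1_repr y) => c c'.
apply: etrans (congr1 (h1_res A p F F') (esym (h1_classD c c'))) _.
apply: etrans (h1_res_class (c + c')) _.
apply: etrans _ (esym (congr2 +%R (h1_res_class c) (h1_res_class c'))).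
apply: etrans _ (h1_classD (cocycle_res c) (cocycle_res c')).
by congr h1_class; apply: val_inj.
Qed.

(** Inflation-restriction at the level of cocycles: subtracting the coboundary of the [P] that
    trivialises [c] over [F'] gives [c1], which vanishes on the group of [F']. Normality of [F']
    makes the values of [c1] points over [F'], so p^B kills them. *)
Lemma h1_res_ker B (x : H1 A p F) : galois_ext F' ->
  kpts_tors A p F' #<= `I_B -> h1_res A p F F' x = 0 -> x *+ (p ^ B) = 0.
Proof.
move=> galF' torsB; rewrite -(h1_reprK x); move: (h1_repr x) => {x} c.
move=> /(etrans (esym (h1_res_class c)))/h1_class_eq0[m [P Pm cP]].
have /asboolP[k [cp cM cC]] := valP c; rewrite /= in cP.
pose c1 sigma := val c sigma - (gact sigma P - P).
have c1M sigma tau : in_gal F sigma -> in_gal F tau ->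
    c1 (sigma \o tau : Aut) = c1 sigma + gact sigma (c1 tau).
  move=> sF tF; rewrite /c1 cM // (gactM _ sF tF) !(gactB sF).
  rewrite addrACA; congr (_ + _); rewrite -opprD; congr (- _).
  by rewrite [X in _ = X]addrC subrKA.
(* Continuity of [c] is what makes its value depend only on the pointwise values of an
   automorphism. *)
have c1_ext (sigma tau : Aut) : in_gal F sigma -> sigma =1 tau -> c1 sigma = c1 tau.
  move=> sF st; have tF : in_gal F tau by move=> y Fy; rewrite -st sF.
  have [s cs] := cC _ sF; have ctau := cs tau tF (fun y _ => st y).
  exact: (congr2 (fun u v => u - (v - P)) (esym ctau) (gact_ext P sF st)).
have c1_0 tau : in_gal F' tau -> c1 tau = 0.
  by move=> tF'; apply/eqP; rewrite subr_eq0; apply/eqP; exact: (cP tau tF').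
have c1_fix sigma tau : in_gal F sigma -> in_gal F' tau ->
    gact tau (c1 sigma) = c1 sigma.
  move=> sF tF'; have tF := in_galS tF'.
  (* The product of [tau] and [sigma] is also that of [sigma] and its conjugate [tau'], which fixes
     [F'] by normality. As [c1] vanishes at [tau] and [tau'], expanding both products shows that
     [tau] fixes [c1 sigma]. *)
  pose tau' : Aut := algC_invaut sigma \o (tau \o sigma).
  have t'F' : in_gal F' tau'.
    move=> y F'y; rewrite /tau' /= tF' ?algC_autK //.
    by apply: galF' F'y => z Kz; apply: sF; apply: fe_sub.
  have e : c1 (tau \o sigma : Aut) = c1 (sigma \o tau' : Aut).
    apply: c1_ext; first exact: in_gal_comp.
    by move=> y; rewrite /= algC_invautK.
  have := etrans (esym (c1M _ _ tF sF)) (etrans e (c1M _ _ sF (in_galS t'F'))).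
  by rewrite (c1_0 _ tF') (c1_0 _ t'F') add0r (gact0 _ sF) addr0.
have c1B sigma : in_gal F sigma -> c1 sigma *+ (p ^ B) = 0.
  move=> sF; have c1p : c1 sigma *+ (p ^ (k + m)) = 0.
    rewrite mulrnBl (mulrn_pow0 _ (cp _ sF)) sub0r mulrnBl -(gactMn _ _ sF).
    by rewrite addnC (mulrn_pow0 _ Pm) (gact0 _ sF) !subr0 oppr0.
  apply: (tors_card_exponent torsB _ c1p) => i; split; last first.
    by exists (k + m)%N; rewrite mulrnAC c1p mul0rn.
  apply: proj_fixed_rational => tau tF'.
  apply: etrans (esym (val_pt_map _ (in_gal_ext tF'))) _; congr val.
  by apply: etrans (gactMn _ _ tF') _; rewrite c1_fix.
apply: etrans (esym (h1_classMn c _)) _; apply/h1_class_eq0.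
exists m, (P *+ (p ^ B)) => [|sigma sF].
  by rewrite mulrnAC Pm mul0rn.
apply/eqP; rewrite val_cocyclesMn (gactMn _ _ sF) -mulrnBl -subr_eq0 -mulrnBl.
by apply/eqP; apply: c1B.
Qed.

End Restriction.

Lemma h1_res_comp F F' F'' (x : H1 A p F) :
  {subset F <= F'} -> {subset F' <= F''} ->
  h1_res A p F' F'' (h1_res A p F F' x) = h1_res A p F F'' x.
Proof.
move=> FF' F'F''; have FF'' : {subset F <= F''} by move=> y /FF'/F'F''.
rewrite -(h1_reprK x); move: (h1_repr x) => {x} c.
apply: etrans (congr1 (h1_res A p F' F'') (h1_res_class FF' c)) _.
apply: etrans (h1_res_class F'F'' (cocycle_res FF' c)) _.
apply: etrans _ (esym (h1_res_class FF'' c)).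
by congr h1_class; apply: val_inj.
Qed.

End Classes.

Lemma coprime_tors_eq0 (X : zmodType) (x : X) (a b : nat) :
  coprime a b -> x *+ a = 0 -> x *+ b = 0 -> x = 0.
Proof.
move=> cab xa xb; have [[u v] /= uv] : exists uv, uv.1 * a%:Z + uv.2 * b%:Z = 1.
  exact/coprimezP.
rewrite -[x]mulr1z -uv mulrzDr (mulrC u) (mulrC v) 2!mulrzA -!pmulrn xa xb.
by rewrite !mul0rz addr0.
Qed.

Section Isogenies.
Variables (K : numField) (A A' : abVar K) (phi : isogeny A A') (p : nat).

Definition cocycle_isog (F : finExt K) (c : cocycles A p F) : cocycles A' p F :=
  exist (fun c => c \in Z1 A' p F) _ (isog_Z1 phi c).

Lemma h1_isog_class (F : finExt K) (c : cocycles A p F) :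
  h1_isog phi (h1_class c) = h1_class (cocycle_isog c).
Proof. exact: h1_isogE. Qed.

Let phi_additive : additive_on setT (fun x : gavpts A => av_app phi x : gavpts A').
Proof. by move=> x y _ _; apply: iso_hom. Qed.

Let phiB (x y : gavpts A) : av_app phi (x - y) = av_app phi x - av_app phi y.
Proof. exact: (additive_onB _ phi_additive). Qed.

Lemma h1_isogB (F : finExt K) (x y : H1 A p F) :
  h1_isog phi (x - y) = h1_isog phi x - h1_isog phi y.
Proof.
rewrite -(h1_reprK x) -(h1_reprK y); move: (h1_repr x) (h1_repr y) => c c'.
apply: etrans (congr1 (@h1_isog K A A' phi p F) (esym (h1_classB c c'))) _.
apply: etrans (h1_isog_class (c - c')) _.
apply: etrans _ (esym (congr2 +%R (h1_isog_class c) (congr1 -%R (h1_isog_class c')))).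
apply: etrans _ (h1_classB (cocycle_isog c) (cocycle_isog c')).
congr h1_class; apply: val_inj; apply/funext => sigma.
apply: etrans _ (esym (val_cocyclesB _ _ sigma)).
apply: etrans _ (phiB (val c sigma) (val c' sigma)).
exact: (congr1 (fun z : gavpts A => av_app phi z) (val_cocyclesB c c' sigma)).
Qed.

Lemma h1_isog_res (F F' : finExt K) (x : H1 A p F) : {subset F <= F'} ->
  h1_isog phi (h1_res A p F F' x) = h1_res A' p F F' (h1_isog phi x).
Proof.
move=> FF'; rewrite -(h1_reprK x); move: (h1_repr x) => {x} c.
apply: etrans (congr1 (@h1_isog K A A' phi p F') (h1_res_class FF' c)) _.
apply: etrans (h1_isog_class (cocycle_res FF' c)) _.
apply: etrans _ (esym (congr1 (h1_res A' p F F') (h1_isog_class c))).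
apply: etrans _ (esym (h1_res_class FF' (cocycle_isog c))).
by congr h1_class; apply: val_inj.
Qed.

Lemma isog_deg_gt0 : (0 < isog_deg phi)%N.
Proof.
rewrite /isog_deg cardfs_gt0; apply/fset0Pn; exists 0.
rewrite in_fset_set; last exact: iso_fin.
by rewrite inE; apply: (additive_on0 _ phi_additive).
Qed.

(** Translation by [x] permutes the finite kernel, so comparing the sum of its elements before and
    after gives the claim. *)
Lemma isog_ker_deg (x : gavpts A) : av_app phi x = 0 -> x *+ isog_deg phi = 0.
Proof.
move=> x0; have finK := iso_fin phi; pose S := fset_set (mor_ker phi).
have SE y : (y \in S) = `[< av_app phi y = 0 >].
  by rewrite /S in_fset_set //; apply/idP/asboolP => /=; rewrite inE.
have perm_S : perm_eq [seq y + x | y <- S] S.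
  apply: uniq_perm => [||y]; rewrite ?fset_uniq //.
    by rewrite map_inj_uniq ?fset_uniq // => u v /addIr.
  apply/mapP/idP => [[z zS ->]|yS].
    by move: zS; rewrite !SE => /asboolP z0; apply/asboolP; rewrite iso_hom z0 x0 addr0.
  exists (y - x); rewrite ?subrK //; move: yS; rewrite !SE => /asboolP y0.
  by apply/asboolP; rewrite phiB y0 x0 subr0.
have : \sum_(y <- [seq y + x | y <- S]) y = \sum_(y <- S) y by apply: perm_big.
rewrite big_map big_split /= => /(canRL (addKr _)); rewrite addNr.
by rewrite big_const_seq count_predT iter_addr_0.
Qed.

(* The values of a suitable cohomologous cocycle lie in the [p]-part of the
   kernel of [phi], which is killed by [p ^ logn p (isog_deg phi)]. *)
Lemma h1_isog_ker (F : finExt K) (x : H1 A p F) : prime p ->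
  h1_isog phi x = 0 -> x *+ (p ^ logn p (isog_deg phi)) = 0.
Proof.
move=> pp; rewrite -(h1_reprK x); move: (h1_repr x) => {x} c.
move=> /(etrans (esym (h1_isog_class c)))/h1_class_eq0[m [P' P'm cP']].
have /asboolP[k [cp _ _]] := valP c; rewrite /= in cP'.
have [u pu degE] := pfactor_coprime pp isog_deg_gt0.
set a := logn p _ in degE *.
have upk n : coprime u (p ^ n) by rewrite coprime_sym coprimeXl.
have [Q QP'] := iso_surj phi P'.
have Qdeg : Q *+ (p ^ m) *+ isog_deg phi = 0.
  by apply: isog_ker_deg; rewrite av_appMn QP'.
have [[s t] /= st] : exists uv, uv.1 * u%:Z + uv.2 * (p ^ m)%N%:Z = 1.
  exact/coprimezP/upk.
(* The factor [u * s] is 1 modulo p^m and a multiple of [u]: it keeps the image [P'] and removes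
   from [Q] the torsion prime to [p]. *)
pose Q' := Q *~ (u%:Z * s).
have phiQ' : av_app phi Q' = P'.
  rewrite /Q' (additive_onMz (D := setT) _ phi_additive) // QP'.
  rewrite -[RHS]mulr1z -st mulrzDr (mulrC t) (mulrzA _ (p ^ m)%N%:Z) -pmulrn P'm.
  by rewrite mul0rz addr0 mulrC.
have Q'p : Q' *+ (p ^ (m + a)) = 0.
  rewrite /Q' mulrzA pmulrn mulrzAC -!pmulrn.
  suff -> : Q *+ u *+ (p ^ (m + a)) = 0 by rewrite mul0rz.
  by rewrite -Qdeg degE -!mulrnA expnD mulnCA.
pose c1 sigma := val c sigma - (gact sigma Q' - Q').
have c1a sigma : in_gal F sigma -> c1 sigma *+ (p ^ a) = 0.
  move=> sF; have c10 : av_app phi (c1 sigma) = 0.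
    rewrite phiB [av_app phi (gact _ _ - _)]phiB cP' // -phiQ'.
    by rewrite /gact [in X in X - _ - _](pt_map_mor (in_gal_ext sF) phi) subrr.
  have c1p : c1 sigma *+ (p ^ (k + (m + a))) = 0.
    rewrite mulrnBl (mulrn_pow0 _ (cp _ sF)) sub0r mulrnBl -(gactMn _ _ sF).
    by rewrite addnC (mulrn_pow0 _ Q'p) (gact0 _ sF) !subr0 oppr0.
  apply: (coprime_tors_eq0 (upk (k + (m + a))%N)).
    by rewrite -mulrnA mulnC -degE; apply: isog_ker_deg.
  by rewrite mulrnAC c1p mul0rn.
apply: etrans (esym (h1_classMn c _)) _; apply/h1_class_eq0.
exists (m + a)%N, (Q' *+ (p ^ a)) => [|sigma sF].
  by rewrite mulrnAC Q'p mul0rn.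
apply/eqP; rewrite val_cocyclesMn (gactMn _ _ sF) -mulrnBl -subr_eq0 -mulrnBl.
by apply/eqP; apply: c1a.
Qed.

End Isogenies.
End Cohomology.

(** * Relative algebraic closure *)

Section AlgebraicClosureIn.
Local Open Scope ring_scope.
Variables (L : fieldType) (C : closedFieldType) (i : {rmorphism L -> C}).

Definition algebraic_in : {pred C} := fun x => `[< algebraicOver i x >].

Lemma algebraic_inP x : reflect (algebraicOver i x) (x \in algebraic_in).
Proof. exact: asboolP. Qed.

Lemma algebraic_in_divring : divring_closed algebraic_in.
Proof.
split=> [|x y /algebraic_inP xi /algebraic_inP yi|x y /algebraic_inP xi /algebraic_inP yi];
  apply/algebraic_inP; [exact: algebraic1 | exact: algebraic_sub | exact: algebraic_div].
Qed.

HB.instance Definition _ :=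
  GRing.isDivringClosed.Build C algebraic_in algebraic_in_divring.

Definition alg_closure := {x : C | x \in algebraic_in}.

HB.instance Definition _ := SubChoice.on alg_closure.
HB.instance Definition _ := [SubChoice_isSubIntegralDomain of alg_closure by <:].
HB.instance Definition _ := [SubIntegralDomain_isSubField of alg_closure by <:].

(** A monic equation has a root in [C]; being integral over elements algebraic over [L], the root is
    itself algebraic over [L]. *)
Lemma alg_closure_closed : GRing.closed_field_axiom alg_closure.
Proof.
move=> n P n0; have [x xE] := solve_monicpoly (fun k => val (P k)) n0.
suff xi : x \in algebraic_in.
  exists (exist _ x xi : alg_closure); apply: val_inj.
  rewrite (rmorphXn val) (rmorph_sum val) [LHS]xE; apply: eq_bigr => k _.
  by rewrite (rmorphM val) (rmorphXn val).
pose q := 'X^n - \poly_(k < n) val (P k).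
have sz : (size (- \poly_(k < n) val (P k)) < size ('X^n : {poly C}))%N.
  by rewrite size_polyN size_polyXn ltnS size_poly.
apply/algebraic_inP/integral_algebraic.
apply: (@integral_root_monic _ _ _ _ q).
- by rewrite monicE lead_coefDl // lead_coefXn.
- rewrite /root !hornerE horner_poly xE; apply/eqP; exact: subrr.
apply/integral_poly => k; rewrite coefB coefXn coef_poly.
apply: integral_sub; first by case: (k == n); [exact: integral1 | exact: integral0].
case: ifP => _; last exact: integral0.
by apply/integral_algebraic/algebraic_inP; apply: valP.
Qed.

HB.instance Definition _ := Field_isAlgClosed.Build alg_closure alg_closure_closed.

Lemma algebraic_in_id a : i a \in algebraic_in.
Proof. exact/algebraic_inP/algebraic_id. Qed.

Definition alg_closure_in (a : L) : alg_closure := exist _ (i a) (algebraic_in_id a).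

Lemma alg_closure_in_zmod : zmod_morphism alg_closure_in.
Proof. by move=> a b; apply: val_inj; rewrite /= rmorphB. Qed.
Lemma alg_closure_in_monoid : monoid_morphism alg_closure_in.
Proof. by split=> [|a b]; apply: val_inj; rewrite /= ?rmorph1 ?rmorphM. Qed.
HB.instance Definition _ :=
  GRing.isZmodMorphism.Build L alg_closure alg_closure_in alg_closure_in_zmod.
HB.instance Definition _ :=
  GRing.isMonoidMorphism.Build L alg_closure alg_closure_in alg_closure_in_monoid.

Lemma alg_closure_algebraic (x : alg_closure) :
  exists2 f : {poly L}, f != 0 & root (map_poly alg_closure_in f) x.
Proof.
have /algebraic_inP[f f0 fx] := valP x; exists f => //.
by rewrite -(fmorph_root (val : {rmorphism alg_closure -> C})) -map_poly_comp.
Qed.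

Section Algebraics.
Variable j : {rmorphism algC -> C}.

(** Denominators are cleared in the minimal polynomial because integers map to any ring. The
    polynomial stays non-zero over [L] since the maps to [C] show that [L] has characteristic 0. *)
Lemma algebraic_in_algC x : j x \in algebraic_in.
Proof.
have [q [_ q_monic] qx] := minCpolyP x.
have [f [a a0 qE]] := rat_poly_scale q.
have fx : root (map_poly (intr : int -> algC) f) x.
  have := qx q; rewrite dvdpp qE linearZ /= rootZ.
    rewrite -map_poly_comp (eq_map_poly (g := intr)) // => k /=.
    exact: rmorph_int.
  by rewrite fmorph_eq0 invr_eq0 intr_eq0.
have f0 : f != 0.
  by apply: contraTneq (monic_neq0 q_monic) => f0; rewrite qE f0 rmorph0 scaler0 eqxx.
apply/algebraic_inP; exists (map_poly intr f); last first.
  rewrite -map_poly_comp -(fmorph_root j) -map_poly_comp in fx *.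
  rewrite (eq_map_poly (g := j \o intr)) // => k /=.
  by rewrite !rmorph_int.
apply: contraNneq f0 => fL; apply/eqP/polyP => k; rewrite coef0.
have /(congr1 (fun g : {poly L} => i g`_k)) := fL.
rewrite coef_map coef0 rmorph0 rmorph_int -(rmorph_int j) => /eqP.
by rewrite fmorph_eq0 intr_eq0 => /eqP.
Qed.

Definition alg_closure_algC (x : algC) : alg_closure :=
  exist _ (j x) (algebraic_in_algC x).

Lemma alg_closure_algC_zmod : zmod_morphism alg_closure_algC.
Proof. by move=> a b; apply: val_inj; rewrite /= rmorphB. Qed.
Lemma alg_closure_algC_monoid : monoid_morphism alg_closure_algC.
Proof. by split=> [|a b]; apply: val_inj; rewrite /= ?rmorph1 ?rmorphM. Qed.
HB.instance Definition _ := GRing.isZmodMorphism.Build algC alg_closure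
  alg_closure_algC alg_closure_algC_zmod.
HB.instance Definition _ := GRing.isMonoidMorphism.Build algC alg_closure
  alg_closure_algC alg_closure_algC_monoid.

End Algebraics.

Lemma alg_closure_aut (sigma : {rmorphism C -> C}) : sigma \o i =1 i ->
  exists sigma' : {rmorphism alg_closure -> alg_closure},
    forall x, val (sigma' x) = sigma (val x).
Proof.
move=> si; have sA (x : alg_closure) : sigma (val x) \in algebraic_in.
  have /algebraic_inP[f f0 fx] := valP x; apply/algebraic_inP; exists f => //.
  by rewrite -(eq_map_poly si) map_poly_comp fmorph_root.
pose s x : alg_closure := exist _ (sigma (val x)) (sA x).
have s_zmod : zmod_morphism s by move=> a b; apply: val_inj; rewrite /= !rmorphB.
have s_monoid : monoid_morphism s.
  by split=> [|a b]; apply: val_inj; rewrite /= ?rmorph1 ?rmorphM.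
pose s_add := GRing.isZmodMorphism.Build _ _ s s_zmod.
pose s_mul := GRing.isMonoidMorphism.Build _ _ s s_monoid.
by exists (HB.pack_for {rmorphism alg_closure -> alg_closure} s s_add s_mul).
Qed.

End AlgebraicClosureIn.

(** * Completions *)

Section Completions.
Local Open Scope ring_scope.

Section AbsoluteValue.
Variables (F : numField) (w : completion F).
Local Notation "`| a |_w" := (cp_abs (c := w) a) (at level 0, format "`| a |_w").
Implicit Types a b : cp_field w.

Lemma cp_abs1 : `|1|_w = 1.
Proof.
have n0 : `|1|_w != 0 by rewrite cp_abs_eq0 oner_eq0.
by apply: (mulfI n0); rewrite -cp_absM !mulr1.
Qed.

Lemma cp_abs0 : `|0|_w = 0.
Proof. by apply/eqP; rewrite cp_abs_eq0. Qed.

Lemma cp_absN a : `|- a|_w = `|a|_w.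
Proof.
have e : `|-1|_w = 1.
  have /eqP : `|-1|_w ^+ 2 = 1 by rewrite expr2 -cp_absM mulrNN mulr1 cp_abs1.
  rewrite sqrf_eq1 => /orP[/eqP //|/eqP e].
  by have := cp_abs_ge0 (-1 : cp_field w); rewrite e; lra.
by rewrite -mulN1r cp_absM e mul1r.
Qed.

Lemma cp_absX a n : `|a ^+ n|_w = `|a|_w ^+ n.
Proof. by elim: n => [|n IHn]; rewrite ?expr0 ?cp_abs1 // !exprS cp_absM IHn. Qed.

Lemma cp_absV a : `|a^-1|_w = `|a|_w^-1.
Proof.
have [->|a0] := eqVneq a 0; first by rewrite invr0 cp_abs0 invr0.
have n0 : `|a|_w != 0 by rewrite cp_abs_eq0.
by apply: (mulfI n0); rewrite -cp_absM !mulfV // cp_abs1.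
Qed.

Lemma cp_absB a b : `|a - b|_w <= `|a|_w + `|b|_w.
Proof. by rewrite -(cp_absN b) cp_absD. Qed.

Lemma cp_abs_le_sub a b : `|a|_w <= `|b|_w + `|a - b|_w.
Proof. by rewrite -{1}(subrK b a) addrC cp_absD. Qed.

Lemma cp_abs_distC a b : `|a - b|_w = `|b - a|_w.
Proof. by rewrite -opprB cp_absN. Qed.

Lemma cp_abs_sum n (f : 'I_n -> cp_field w) :
  `|\sum_i f i|_w <= \sum_i `|f i|_w.
Proof.
elim/big_ind2: _ => [|x1 x2 y1 y2 h1 h2|//]; first by rewrite cp_abs0.
by apply: le_trans (cp_absD _ _) _; apply: lerD.
Qed.

End AbsoluteValue.

Section Closure.
Variables (F F' : numField) (w : completion F').
Local Notation "`| a |_w" := (cp_abs (c := w) a) (at level 0, format "`| a |_w").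

Definition cp_closure_pred : {pred cp_field w} := fun a =>
  `[< forall e : cp_real w, 0 < e -> exists x b,
      [/\ x \in F, cp_in w b = cp_iota w x & `|a - b|_w < e] >].

Lemma cp_closureP a : reflect (forall e : cp_real w, 0 < e -> exists x b,
    [/\ x \in F, cp_in w b = cp_iota w x & `|a - b|_w < e])
  (a \in cp_closure_pred).
Proof. exact: asboolP. Qed.

Lemma cp_closure_base b x :
  x \in F -> cp_in w b = cp_iota w x -> b \in cp_closure_pred.
Proof.
move=> Fx bx; apply/cp_closureP => e e0; exists x, b.
by rewrite subrr cp_abs0.
Qed.

Lemma cp_closureB : {in cp_closure_pred &, forall a b, a - b \in cp_closure_pred}.
Proof.
move=> a b /cp_closureP ha /cp_closureP hb; apply/cp_closureP => e e0.
have e2 : 0 < e / 2 by lra.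
have [[x [a' [Fx ax aa]]] [y [b' [Fy by_ bb]]]] := (ha _ e2, hb _ e2).
exists (x - y), (a' - b'); split; [exact: rpredB | by rewrite !rmorphB ax by_ | ].
rewrite subBACA; apply: le_lt_trans (cp_absB _ _) _; lra.
Qed.

Lemma cp_closureM : {in cp_closure_pred &, forall a b, a * b \in cp_closure_pred}.
Proof.
move=> a b /cp_closureP ha /cp_closureP hb; apply/cp_closureP => e e0.
have a0 : 0 < `|a|_w + 1 by have := cp_abs_ge0 a; lra.
have b0 : 0 < `|b|_w + 1 by have := cp_abs_ge0 b; lra.
have ea : 0 < e / 2 / (`|a|_w + 1) by rewrite divr_gt0 //; lra.
have eb : 0 < e / 2 / (`|b|_w + 1) by rewrite divr_gt0 //; lra.
(* The bound 1 keeps |b'| at most |b| + 1, the quantity by which the error on [a] gets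
   multiplied. *)
have em : 0 < Num.min 1 (e / 2 / (`|a|_w + 1)) by rewrite lt_min ltr01.
have [x [a' [Fx ax aa]]] := ha _ eb.
have [y [b' [Fy by_]]] := hb _ em.
rewrite lt_min => /andP[bb1 bb2].
exists (x * y), (a' * b'); split; [exact: rpredM | by rewrite !rmorphM ax by_ | ].
have -> : a * b - a' * b' = (a - a') * b' + a * (b - b').
  by rewrite mulrBl mulrBr [RHS]addrC subrKA.
apply: le_lt_trans (cp_absD _ _) _; rewrite !cp_absM.
have b'b : `|b'|_w <= `|b|_w + 1.
  by apply: le_trans (cp_abs_le_sub b' b) _; rewrite lerD2l cp_abs_distC ltW.
have h1 : `|a - a'|_w * `|b'|_w <= e / 2.
  rewrite -[leRHS](divfK (lt0r_neq0 b0)).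
  by apply: ler_pM => //; rewrite ?cp_abs_ge0 // ltW.
have h2 : `|a|_w * `|b - b'|_w < e / 2.
  rewrite -[ltRHS](divfK (lt0r_neq0 a0)) mulrC.
  apply: le_lt_trans (_ : `|b - b'|_w * (`|a|_w + 1) < _).
    by rewrite ler_wpM2l ?cp_abs_ge0 // lerDl ler01.
  by rewrite ltr_pM2r.
lra.
Qed.

Lemma cp_closureV : {in cp_closure_pred, forall a, a^-1 \in cp_closure_pred}.
Proof.
move=> a /cp_closureP ha; apply/cp_closureP => e e0.
have [->|a0] := eqVneq a 0.
  by exists 0, 0; rewrite invr0 subrr cp_abs0 !rmorph0 rpred0.
have t0 : 0 < `|a|_w by rewrite lt_def cp_abs_eq0 a0 cp_abs_ge0.
(* The first bound keeps |b| above |a|/2; the second then makes |b - a| / (|a| |b|) less than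
   [e]. *)
have em : 0 < Num.min (`|a|_w / 2) (e * `|a|_w * (`|a|_w / 2)).
  by rewrite lt_min !mulr_gt0 //; lra.
have [x [b [Fx bx]]] := ha _ em; rewrite lt_min => /andP[ab1 ab2].
have tb : `|a|_w / 2 < `|b|_w.
  by have := cp_abs_le_sub a b; lra.
have b0 : b != 0 by rewrite -(cp_abs_eq0 b); apply: lt0r_neq0; lra.
exists x^-1, b^-1; split; [by rewrite rpredV | by rewrite !fmorphV bx | ].
have -> : a^-1 - b^-1 = (b - a) / (a * b).
  by rewrite mulrBl invfM mulrCA mulfV // mulr1 mulrA mulfV // mul1r.
rewrite cp_absM cp_absV cp_absM cp_abs_distC ltr_pdivrMr ?mulr_gt0 //; last by lra.
apply: lt_le_trans ab2 _; rewrite -mulrA ler_wpM2l ?ltW //.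
by rewrite ltr_pM2l.
Qed.

Lemma cp_closure_divring : divring_closed cp_closure_pred.
Proof.
split=> [||a b Ca Cb]; [ | exact: cp_closureB | ].
  by apply: (@cp_closure_base _ 1); rewrite ?rpred1 ?rmorph1.
by apply: cp_closureM => //; apply: cp_closureV.
Qed.

HB.instance Definition _ :=
  GRing.isDivringClosed.Build _ cp_closure_pred cp_closure_divring.

Definition cp_closure := {a : cp_field w | a \in cp_closure_pred}.

HB.instance Definition _ := SubChoice.on cp_closure.
HB.instance Definition _ := [SubChoice_isSubIntegralDomain of cp_closure by <:].
HB.instance Definition _ := [SubIntegralDomain_isSubField of cp_closure by <:].

Definition cp_closure_in : {rmorphism cp_closure -> cp_clos w} :=
  cp_in w \o (val : {rmorphism cp_closure -> cp_field w}).

Lemma cp_closure_complete (u : nat -> cp_closure) :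
  (forall e, 0 < e -> exists n0, forall m n, (n0 <= m)%N -> (n0 <= n)%N ->
     `|val (u m - u n)|_w < e) ->
  exists l : cp_closure, forall e, 0 < e -> exists n0, forall n, (n0 <= n)%N ->
     `|val (u n - l)|_w < e.
Proof.
move=> cauchy; have [l lP] := cp_complete (c := w) (u := fun n => val (u n)) cauchy.
suff Cl : l \in cp_closure_pred by exists (exist _ l Cl : cp_closure).
apply/cp_closureP => e e0; have e2 : 0 < e / 2 by lra.
have [n lt_e] := lP _ e2; have /cp_closureP/(_ _ e2)[x [b [Fx bx ub]]] := valP (u n).
exists x, b; split=> //; rewrite -(subrKA (val (u n))).
apply: le_lt_trans (cp_absD _ _) _; rewrite (cp_abs_distC l).
have := lt_e n (leqnn n); lra.
Qed.

End Closure.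
End Completions.

(** * Restriction of places *)

Section Descent.
Local Open Scope ring_scope.

(** Bernoulli's inequality and the Archimedean property. *)
Lemma expr_unbounded (R : archiRealFieldType) (t : R) :
  1 < t -> exists k, 2 <= t ^+ k.
Proof.
move=> t1; have bern k : 1 + (t - 1) *+ k <= t ^+ k.
  elim: k => [|k IHk]; first by rewrite mulr0n addr0.
  have h : 0 <= (t - 1) *+ k by rewrite mulrn_wge0 //; lra.
  rewrite exprS mulrS; set s := _ *+ k in IHk h *.
  have : (1 + s) * t <= t ^+ k * t by rewrite ler_wpM2r //; lra.
  have : 0 <= s * (t - 1) by rewrite mulr_ge0 //; lra.
  by rewrite [t * _]mulrC !mulrDl mulrDr; lra.
have d0 : 0 < t - 1 by lra.
exists (Num.bound (t - 1)^-1); apply: le_trans (bern _).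
have := archi_boundP (ltW (_ : 0 < (t - 1)^-1)); rewrite invr_gt0 => /(_ d0) lt_b.
have : 1 < (t - 1) * (Num.bound (t - 1)^-1)%:R.
  by rewrite -[X in X < _](mulfV (lt0r_neq0 d0)) ltr_pM2l.
by rewrite mulr_natr; lra.
Qed.

Lemma geometric_sum_le (R : realFieldType) (t : R) n :
  2 <= t -> \sum_(i < n) t ^+ i <= t ^+ n - 1.
Proof.
move=> t2; elim: n => [|n IHn]; first by rewrite big_ord0 expr0 subrr.
have tn : 0 <= t ^+ n by rewrite exprn_ge0 //; lra.
have : 0 <= (t - 2) * t ^+ n by rewrite mulr_ge0 //; lra.
by rewrite big_ord_recr /= exprS mulrBl; lra.
Qed.

Section Restrict.
Variables (F F' : numField) (w : completion F').
Hypothesis FF' : {subset F <= F'}.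
Local Notation "`| a |_w" := (cp_abs (c := w) a) (at level 0, format "`| a |_w").

(* An absolute value trivial on Q is bounded by 1 on algebraic elements: if
   [`|y| >= 2] then [`|y|^n <= \sum_(i < n) `|y|^i < `|y|^n]. *)
Lemma cp_closure_nontriv :
  exists2 a : cp_closure F w, a != 0 & `|val a|_w != 1.
Proof.
apply: contrapT => triv.
have abs_le1 a : a \in @cp_closure_pred F F' w -> `|a|_w <= 1.
  move=> Ca; have [->|a0] := eqVneq a 0; first by rewrite cp_abs0 ler01.
  rewrite le_eqVlt; apply/orP; left; apply: contrapT => /negP a1; apply: triv.
  by exists (exist _ a Ca : cp_closure F w).
have [a a1] : exists a : cp_field w, 1 < `|a|_w.
  have [a a0 a1] := cp_nontriv w.
  have t0 : 0 < `|a|_w by rewrite lt_def cp_abs_eq0 a0 cp_abs_ge0.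
  case: (ltgtP `|a|_w 1) a1 => // ta _; last by exists a.
  by exists a^-1; rewrite cp_absV invf_gt1.
(* By density [a] is replaced by an element of [F'], which is algebraic over Q; a power of it then
   has absolute value at least 2. *)
have [|x [b [F'x bx ab]]] := cp_dense a (e := `|a|_w - 1); first by lra.
have b1 : 1 < `|b|_w by have := cp_abs_le_sub a b; lra.
have [k b2] := expr_unbounded b1.
rewrite -cp_absX in b2; set c := b ^+ k in b2.
have cx : cp_in w c = cp_iota w (x ^+ k) by rewrite !rmorphXn bx.
have [q [_ q_monic] /(_ q)] := minCpolyP (x ^+ k).
rewrite dvdpp => /eqP qx.
have ratE (r : rat) : exists2 d, cp_in w d = cp_iota w (ratr r) & `|d|_w <= 1.
  have Fr : ratr r \in F by apply: rpred_rat.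
  have [d dr] := cp_sub w (FF' Fr); exists d => //.
  by apply: abs_le1; apply: cp_closure_base dr.
have /choice[d dP] : forall i, exists d, cp_in w d = cp_iota w (ratr q`_i) /\ `|d|_w <= 1.
  by move=> i; have [d] := ratE q`_i; exists d.
have [n szq] : exists n, size q = n.+1.
  by exists (size q).-1; rewrite prednK // lt0n size_poly_eq0 monic_neq0.
have cE : c ^+ n = - \sum_(i < n) d i * c ^+ i.
  apply: (fmorph_inj (cp_in w)); rewrite rmorphXn rmorphN rmorph_sum /=.
  apply/eqP; rewrite -addr_eq0 addrC; apply/eqP.
  have := congr1 (cp_iota w) qx; rewrite rmorph0 horner_coef size_map_poly szq.
  rewrite big_ord_recr /= coef_map /= -[X in q`_X]/(n.+1.-1) -szq -lead_coefE.
  rewrite (monicP q_monic) rmorph1 mul1r rmorphD rmorphXn -cx rmorph_sum.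
  move=> e0; rewrite -[RHS]e0; congr (_ + _); apply: eq_bigr => i _.
  by rewrite coef_map [RHS]rmorphM rmorphM !(rmorphXn _ i) (dP i).1 cx.
have : `|c|_w ^+ n <= \sum_(i < n) `|c|_w ^+ i.
  rewrite -cp_absX cE cp_absN; apply: le_trans (cp_abs_sum _) _.
  apply: ler_sum => i _; rewrite cp_absM cp_absX.
  by rewrite ler_piMl ?exprn_ge0 ?cp_abs_ge0 // (dP i).2.
by have := geometric_sum_le n b2; lra.
Qed.

(* The completion of [F] is the closure of [F] in that of [F'], with algebraic
   closure taken inside [cp_clos w]. *)
Definition completion_restrict : completion F.
Proof.
refine (@Completion F (cp_real w) (cp_closure F w) (fun a => `|val a|_w)
  _ _ _ _ cp_closure_nontriv (@cp_closure_complete F F' w)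
  (alg_closure (cp_closure_in F w)) (alg_closure_in (cp_closure_in F w))
  (@alg_closure_algebraic _ _ (cp_closure_in F w))
  (alg_closure_algC (cp_closure_in F w) (cp_iota w)) _ _).
- by move=> a; apply: cp_abs_ge0.
- by move=> a; rewrite cp_abs_eq0 -val_eqE.
- by move=> a b; rewrite rmorphM cp_absM.
- by move=> a b; rewrite rmorphD cp_absD.
- move=> x Fx; have [a ax] := cp_sub w (FF' Fx).
  exists (exist _ a (cp_closure_base Fx ax)); exact: val_inj.
- move=> a e e0; have /cp_closureP/(_ _ e0)[x [b [Fx bx ab]]] := valP a.
  exists x, (exist _ b (cp_closure_base Fx bx)).
  by split=> //; apply: val_inj.
Defined.

End Restrict.

(** All that local triviality asks of the place below [w]: an embedding of closed fields compatible
    with [algC], and the restriction of local automorphisms along it. *)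
Lemma completion_restrict_aut (F F' : numField) (w : completion F') :
  {subset F <= F'} ->
  exists (v : completion F) (j : {rmorphism cp_clos v -> cp_clos w}),
    (forall x, j (cp_iota v x) = cp_iota w x) /\
    forall sigma : {rmorphism cp_clos w -> cp_clos w},
      sigma \o cp_in w =1 cp_in w ->
      exists2 sigma' : {rmorphism cp_clos v -> cp_clos v},
        sigma' \o cp_in v =1 cp_in v & j \o sigma' =1 sigma \o j.
Proof.
move=> FF'; exists (completion_restrict w FF').
exists (val : {rmorphism alg_closure (cp_closure_in F w) -> cp_clos w}).
split=> // sigma s_in.
have [a|s sE] := @alg_closure_aut _ _ (cp_closure_in F w) sigma; first exact: s_in.
exists s => [a|]; last exact: sE.
by apply: val_inj; rewrite /= [LHS]sE; apply: s_in.
Qed.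

(** The point [P] trivialising [c] at [v] is carried along [j]. An automorphism at [w] induces one
    at [v], and both restrict to the same [tau] on [algC]. *)
Lemma locally_trivial_res (K : numField) (A : abVar K) (F F' : finExt K)
    (c : Aut -> gavpts A) : {subset F <= F'} ->
  locally_trivial F c -> locally_trivial F' c.
Proof.
move=> FF' cF w; have [v [j [jv autP]]] := completion_restrict_aut w FF'.
have [P Pv] := cF v; exists (pt_map (cp_iota w) j P) => sigma tau s_in s_tau.
have [sigma' s'_in js'] := autP _ s_in.
have s'_tau : cp_iota v \o tau =1 sigma' \o cp_iota v.
  move=> x; apply: (fmorph_inj j); have /= -> := js' (cp_iota v x).
  by rewrite !jv; apply: s_tau.
have KF x : x \in K -> x \in F by apply: fe_sub.
have jK : {in K, j \o cp_iota v =1 cp_iota w} by move=> x _; apply: jv.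
have iK : {in K, cp_iota v \o id_algC =1 cp_iota v} by [].
have sK : {in K, sigma \o cp_iota w =1 cp_iota w}.
  move=> x /KF/FF' F'x; have [a ax] := cp_sub w F'x.
  by rewrite /= -ax; apply: s_in.
have s'K : {in K, sigma' \o cp_iota v =1 cp_iota v}.
  move=> x /KF Fx; have [a ax] := cp_sub v Fx.
  by rewrite /= -ax; apply: s'_in.
pose sj : {rmorphism cp_clos v -> cp_clos w} := sigma \o j.
have cE : pt_map (cp_iota w) j (pt_map (cp_iota v) (cp_iota v) (c tau)) =
    pt_map (cp_iota w) (cp_iota w) (c tau) by exact: (pt_map_comp _ iK jK jv).
have sjP : pt_map (cp_iota w) j (pt_map (cp_iota v) sigma' P) =
    pt_map (cp_iota w) sigma (pt_map (cp_iota w) j P).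
  apply: etrans (pt_map_comp (h'' := sj) P s'K jK js') _.
  exact: esym (pt_map_comp (h'' := sj) P jK sK (frefl _)).
apply: etrans (esym cE) _; rewrite (Pv sigma' tau s'_in s'_tau).
by apply: etrans (pt_mapB jK _ _) _; rewrite sjP.
Qed.

End Descent.

(** * Selmer groups *)

Section Selmer.
Local Open Scope classical_set_scope.
Local Open Scope ring_scope.
Variables (K : numField) (A : abVar K) (p : nat).

Lemma Sel_subgroup (F : finExt K) : subgroup (Sel A p F).
Proof.
have iK (v : completion F) : {in K, cp_iota v \o id_algC =1 cp_iota v} by [].
have sK (v : completion F) (sigma : {rmorphism cp_clos v -> cp_clos v}) :
    sigma \o cp_in v =1 cp_in v -> {in K, sigma \o cp_iota v =1 cp_iota v}.
  move=> s_in x Kx; have [a ax] := cp_sub v (fe_sub F Kx).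
  by rewrite /= -ax; apply: s_in.
split.
  exists 0; last exact/esym/h1_class0.
  move=> v; exists 0 => sigma tau s_in _.
  apply: etrans (pt_map0 (iK v) A) _.
  by rewrite (pt_map0 (sK v sigma s_in) A) subrr.
move=> _ _ [c cF ->] [c' c'F ->]; exists (c - c'); last exact/esym/h1_classB.
move=> v; have [[P cP] [P' cP']] := (cF v, c'F v).
exists (P - P') => sigma tau s_in s_tau; rewrite val_cocyclesB.
apply: etrans (pt_mapB (iK v) _ _) _.
rewrite (cP sigma tau s_in s_tau) (cP' sigma tau s_in s_tau).
have e := pt_mapB (sK v sigma s_in) P P'.
refine (etrans (subBACA (pt_map (cp_iota v) sigma P) P _ P') _).
exact: (congr1 (fun z => z - (P - P')) (esym e)).
Qed.

Lemma Sel_res (F F' : finExt K) (x : H1 A p F) : {subset F <= F'} ->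
  Sel A p F x -> Sel A p F' (h1_res A p F F' x).
Proof.
move=> FF' [c cF ->]; exists (cocycle_res FF' c).
  exact: locally_trivial_res cF.
exact: h1_res_class.
Qed.

End Selmer.

Local Open Scope classical_set_scope.
Local Open Scope card_scope.

Theorem theorem7p4 (K : numField) (A : abVar K) (p : nat)
    (Kn : nat -> finExt K)
    (p_prime : prime p)
    (Kn_galois : forall n : nat, galois_ext (Kn n))
    (Kn_tower : forall n : nat, {subset Kn n <= Kn n.+1})
    (tors_bounded :
       exists B : nat, forall n : nat, kpts_tors A p (Kn n) #<= `I_B)
    (rk_bounded :
       exists B : nat, forall n : nat,
         exists2 r : nat, is_rk A p (Kn n) r & r <= B) :
  (exists n0 : nat, forall n n' : nat, n0 <= n -> n <= n' ->
     group_iso (Seldiv A p (Kn n)) (Seldiv A p (Kn n'))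
       (h1_res A p (Kn n) (Kn n'))) /\
  (forall (A' : abVar K) (phi : isogeny A A'),
     exists r lambda : nat,
       [/\ (exists n0 : nat, forall n : nat, n0 <= n -> is_rk A p (Kn n) r),
           lambda <= logn p (isog_deg phi) * r &
           exists n0 : nat, forall n : nat, n0 <= n ->
             Seldiv_ker phi p (Kn n) #= `I_(p ^ lambda)]).
Proof.
have tower n n' : n <= n' -> {subset Kn n <= Kn n'}.
  move=> nn' x; rewrite -(subnKC nn'); elim: (n' - n) => [|k IHk]; first by rewrite addn0.
  by move=> /IHk/Kn_tower; rewrite addnS.
have [B torsB] := tors_bounded.
pose X n : zmodType := H1 A p (Kn n).
pose S n : set (X n) := Sel A p (Kn n).
pose rho n n' : X n -> X n' := h1_res A p (Kn n) (Kn n').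
have sS n : subgroup (S n) := Sel_subgroup A p (Kn n).
have pS n : primary p (S n) by move=> x _; exact: h1_primary.
have rhoD n n' : n <= n' -> additive_on (S n) (@rho n n').
  by move=> /tower KK' x y _ _; exact: h1_resD.
have rhoS n n' : n <= n' -> forall x, S n x -> S n' (rho n n' x).
  by move=> /tower KK' x; exact: Sel_res.
have rho_comp n n' n'' : n <= n' -> n' <= n'' ->
    forall x, S n x -> rho n' n'' (rho n n' x) = rho n n'' x.
  by move=> /tower KK' /tower KK'' x _; exact: h1_res_comp.
have rho_ker n n' : n <= n' -> forall x, S n x ->
    rho n n' x = 0%R -> (x *+ (p ^ B) = 0)%R.
  by move=> /tower KK' x _; exact: h1_res_ker.
split; first exact: (tower_iso p_prime sS pS rhoD rhoS rho_comp rho_ker rk_bounded).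
move=> A' phi.
(* The isogeny enters through the exponent supplied by [h1_isog_ker] and its compatibility with
   restriction. *)
apply: (tower_tors_card p_prime sS pS rhoD rhoS rho_comp rho_ker rk_bounded
  (T := fun n => Seldiv_ker phi p (Kn n)) (a := logn p (isog_deg phi))).
- move=> n; have sD := maxdiv_subgroup (sS n); split.
    split; first exact: (subgroup0 sD).
    by rewrite -(subrr 0%R) h1_isogB subrr.
  move=> x y [Dx fx] [Dy fy]; split; first exact: (subgroupB sD).
  by apply: etrans (h1_isogB phi x y) _; rewrite fx fy subrr.
- by move=> n x [Dx fx]; split=> //; exact: (h1_isog_ker p_prime fx).
- move=> n n' nn' x [Dx fx]; split.
    exact: (maxdiv_image (sS n) (rhoD n n' nn') (rhoS n n' nn') Dx).
  apply: etrans (h1_isog_res phi x (tower _ _ nn')) _; rewrite fx.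
  exact: (additive_on0 (D := setT) (conj I (fun _ _ _ _ => I))
    (fun u v _ _ => h1_resD (tower _ _ nn') u v)).
Qed.
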